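(* Let $A$ be an associative commutative unital finite-dimensional $\mathbb{C}$-algebra. The following conditions are equivalent: (1) $A$ is Gorenstein; (2) all the characteristic numbers of $A$ and of $L^{A^*}$ coincide; (3) the characteristic sequences of $A$ and of $L^{A^*}$ coincide; (4) the characteristic sequence of $A$ is symmetric; (5) the characteristic sequence of $A$ ends with $1$; (6) the characteristic sequence of $A$ ends with a non-zero number.
   Context: An algebra $A$ is Gorenstein if there is a linear functional $\lambda\colon A\to\mathbb{C}$ such that $(a,b)\mapsto\lambda(ab)$ is a perfect pairing on $A$. Characteristic numbers of subspaces. Let $V$ be a complex vector space of dimension $n$. The variety of complete quadrics $\mathcal{CQ}(V)$ is the closure of the image of the rational map $\Phi\colon\mathbb{P}(S^2V)\dashrightarrow\prod_{i=1}^{n-1}\mathbb{P}(S^2(\bigwedge^iV))$, $[\varphi]\mapsto([\bigwedge^i\varphi])_i$, where $\varphi\in S^2V$ is viewed as a symmetric map $V^*\to V$ (in coordinates, $\bigwedge^i\varphi$ is the matrix of $i\times i$ minors of a symmetric matrix). Let $L_i$ be the pullback to $\mathcal{CQ}(V)$ of the hyperplane class of the $i$-th factor. For a linear subspace $L\subset S^2V$ of dimension $d+1$ containing a matrix of rank at least $n-1$, let $X_L$ be the closure of the image under $\Phi$ of the open set of matrices of rank at least $n-1$ in $\mathbb{P}(L)$; $\dim X_L=d$. For non-negative integers $b_1,\dots,b_{n-1}$ with sum $d$, the characteristic number is $c^L_{b_1,\dots,b_{n-1}}=[X_L]\cdot L_1^{b_1}\cdots L_{n-1}^{b_{n-1}}\in\mathbb{Z}$,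 i.e. the number of points of the intersection of $X_L$ with $b_i$ general hyperplanes pulled back from the $i$-th factor, $i=1,\dots,n-1$. If the maximal rank of matrices in $L$ is $k<n-1$, the numbers indexed by $(b_1,\dots,b_k,0,\dots,0)$ are defined in the same way using the truncation of $\Phi$ to the first $k$ factors, and all other characteristic numbers are declared to be $0$. The same definition applies to a linear space $L$ of not necessarily symmetric $n\times n$ matrices, i.e. $L\subset U\otimes W$ with $\dim U=\dim W=n$, using the map $\mathbb{P}(U\otimes W)\dashrightarrow\prod_{i=1}^{n-1}\mathbb{P}(\bigwedge^iU\otimes\bigwedge^iW)$ given by $i\times i$ minors and the variety of complete collineations (the closure of its image) in place of $\mathcal{CQ}(V)$. The characteristic sequence of $L$ is the sequence of numbers indexed by $(d-i,0,\dots,0,i)$, i.e. $[X_L]\cdot L_1^{d-i}L_{n-1}^{i}$, for $i=0,1,\dots,d$ (for $n=2$ both exponents refer to the same class $L_1$; for $n=1$ the only characteristic number is the empty-indexed one, equal to $1$ for $L\ne0$). It is symmetric if its $i$-th and $(d-i)$-th terms agree for all $i$. Subspaces attached to an algebra. For an algebra $A$ of dimension $n$, $L^A\subset S^2A^*$ is the $n$-dimensional space of symmetric bilinear forms $(a,b)\mapsto\lambda(ab)$, $\lambda\in A^*$, and $L^{A^*}\subset A^*\otimes A=\mathrm{Hom}(A,A)$ is the $n$-dimensional space of multiplication maps $b\mapsto ab$, $a\in A$. The characteristic numbers and characteristic sequence of $A$ are those of $L^A$ (with $V=A^*$). *)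

(* Defs.v *)
From HB Require Import structures.
From mathcomp Require Import all_boot all_order all_algebra all_field.
From mathcomp Require Import boolp classical_sets reals.
From mathcomp Require Import complex mpoly.

Set Implicit Arguments.
Unset Strict Implicit.
Unset Printing Implicit Defensive.

Import GRing.Theory.
Local Open Scope ring_scope.
Local Open Scope classical_set_scope.

Section MultiprojectiveSpace.
Variables (K : fieldType) (F : finType) (T : F -> finType).

(* A point of the product over j : F of the projective spaces with
   homogeneous coordinates indexed by T j is an element of [mvec] satisfying
   [mproj_point], taken up to [mproj_eq].  When F is empty this is one point. *)
Definition mvec := forall j : F, {ffun T j -> K^o}.

Definition mproj_point (x : mvec) := forall j, x j != 0.

Definition mproj_eq (x y : mvec) :=
  forall j, exists2 c : K, c != 0 & y j = c *: x j.

Definition mvar := {j : F & T j}.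

Definition mvec_eval (P : {mpoly K[#|{: mvar}|]}) (x : mvec) : K :=
  P.@[fun k => x (tag (enum_val k)) (tagged (enum_val k))].

Definition multihomog (P : {mpoly K[#|{: mvar}|]}) :=
  exists deg : F -> nat, forall m, m \in msupp P ->
    forall j, (\sum_(k < #|{: mvar}| | tag (enum_val k) == j) m k)%N = deg j.

(* Zariski closure in the product of projective spaces of the set of points
   represented by the elements of S. *)
Definition zclosure (S : set mvec) : set mvec := [set x | mproj_point x /\
  forall P, multihomog P ->
    (forall y, S y -> mvec_eval P y = 0) -> mvec_eval P x = 0].

Definition num_points (S : set mvec) (c : nat) :=
  exists p : 'I_c -> mvec,
    [/\ forall k, S (p k),
        forall k l, mproj_eq (p k) (p l) -> k = l &
        forall x, S x -> exists k, mproj_eq (p k) x].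

End MultiprojectiveSpace.

Section GeneralHyperplanes.
Variables (K : fieldType) (F : finType) (T : F -> finType) (b : F -> nat).

(* The coefficients of b j linear forms on the j-th factor, for all j. *)
Definition hyps := mvec K (fun s : {j : F & 'I_(b j)} => T (tag s)).

Definition hyp_section (X : set (mvec K T)) (h : hyps) : set (mvec K T) :=
  [set x | X x /\ forall s, \sum_(t : T (tag s)) h s t * x (tag s) t = 0].

(* The intersection of X with b j general hyperplanes of the j-th factor has
   c points: this holds on a nonempty principal Zariski open set
   [mvec_eval G != 0] in the affine space of tuples of linear forms. *)
Definition general_num_points (X : set (mvec K T)) (c : nat) :=
  exists2 G : {mpoly K[#|{: mvar (fun s : {j : F & 'I_(b j)} => T (tag s))}|]},
    G != 0 & forall h : hyps,
    mproj_point h -> mvec_eval G h != 0 -> num_points (hyp_section X h) c.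

(* Over an infinite field there is at most one such c. *)
Definition intersection_number (X : set (mvec K T)) : nat :=
  xget 0%N [set c | general_num_points X c].

End GeneralHyperplanes.

Section CharacteristicNumbers.
Variables (K : fieldType) (n : nat).

(* The i-element subsets of 'I_n, as increasing maps. *)
Definition minor_idx (i : nat) :=
  {f : {ffun 'I_i -> 'I_n} |
    [forall a : 'I_i, forall b : 'I_i, (a < b)%N ==> (f a < f b)%N]}.

Definition minor (i : nat) (I J : minor_idx i) (M : 'M[K]_n) : K :=
  \det (mxsub (val I) (val J) M).

(* Which entries of the matrix of i x i minors are used as homogeneous
   coordinates on the i-th factor. *)
Definition coord_choice := forall i, {pred minor_idx i * minor_idx i}.

(* P (/\^i U (x) /\^i W) *)
Definition all_minors : coord_choice := fun i => predT.

(* P (S^2 (/\^i V)): the entries of a symmetric matrix on or above the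
   diagonal, for an arbitrary total order on the index sets. *)
Definition sym_minors : coord_choice :=
  fun i => [pred p | (enum_rank p.1 <= enum_rank p.2)%N].

Variable D : coord_choice.

Definition minor_coord (i : nat) :=
  {p : minor_idx i * minor_idx i | p \in @D i}.

Variable L : {vspace 'M[K]_n}.

Definition max_rank : nat :=
  \max_(r < n.+1 | `[< exists2 M, M \in L & \rank M = r >]) r.

(* The value j : 'I_n.-1 stands for the factor given by the minors of size
   j.+1.  If max_rank < n.-1, only the first max_rank factors are kept. *)
Definition factor := {j : 'I_n.-1 | (j < max_rank)%N}.

Definition factor_coord (j : factor) := minor_coord (val j).+1.

Definition Phi (M : 'M[K]_n) : mvec K factor_coord :=
  fun j => [ffun t => minor (val t).1 (val t).2 M].

(* The closure is taken in the whole product; since the variety of complete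
   quadrics (collineations) is closed there, this is also the closure in it. *)
Definition char_variety : set (mvec K factor_coord) :=
  zclosure (Phi @` [set M | [/\ M \in L, M != 0 &
                               (minn max_rank n.-1 <= \rank M)%N]]).

(* b j is the exponent of L_(j+1). *)
Definition char_num (b : 'I_n.-1 -> nat) : nat :=
  if [forall j : 'I_n.-1, (max_rank <= j)%N ==> (b j == 0%N)]
  then intersection_number (fun j : factor => b (val j)) char_variety
  else 0%N.

(* The exponents (d - i, 0, ..., 0, i); both summands apply to the same index
   when n = 2. *)
Definition seq_exponents (d i : nat) : 'I_n.-1 -> nat :=
  fun j => ((if (j : nat) == 0%N then d - i else 0) +
            (if j.+1 == n.-1 then i else 0))%N.

Definition char_seq : seq nat :=
  [seq char_num (seq_exponents (\dim L).-1 i) | i <- iota 0 (\dim L)].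

End CharacteristicNumbers.

Arguments Phi {K n} D L M.
Arguments char_variety {K n} D L.

Definition symmetric_seq (s : seq nat) :=
  forall i, (i < size s)%N -> nth 0%N s i = nth 0%N s ((size s).-1 - i).

Section Algebra.
Variables (K : fieldType) (A : falgType K).

(* lam \o amull a is the functional b |-> lam (a * b), and lam \o amulr b is
   the functional a |-> lam (a * b). *)
Definition gorenstein := exists lam : 'Hom(A, K^o),
  bijective (fun a : A => (lam \o amull a)%VF) /\
  bijective (fun b : A => (lam \o amulr b)%VF).

Variable e : (\dim {:A}).-tuple A.

Definition form_mx (lam : 'Hom(A, K^o)) : 'M[K]_(\dim {:A}) :=
  \matrix_(i, j) lam (e`_i * e`_j).

Fact form_mx_linear : linear form_mx.
Proof. by move=> c u v; apply/matrixP=> i j; rewrite !mxE !lfunE /= lfunE. Qed.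
HB.instance Definition _ := GRing.isLinear.Build K 'Hom(A, K^o)
  'M[K]_(\dim {:A}) *:%R form_mx form_mx_linear.

(* In the basis e, the space L^A of the forms (a, b) |-> lam (a * b). *)
Definition form_space : {vspace 'M[K]_(\dim {:A})} := limg (linfun form_mx).

(* Row i holds the coordinates of a * e_i in e. *)
Definition mult_mx (a : A) : 'M[K]_(\dim {:A}) :=
  \matrix_(i, j) coord e j (a * e`_i).

Fact mult_mx_linear : linear mult_mx.
Proof.
by move=> c u v; apply/matrixP=> i j; rewrite !mxE mulrDl -scalerAl linearP.
Qed.
HB.instance Definition _ := GRing.isLinear.Build K A
  'M[K]_(\dim {:A}) *:%R mult_mx mult_mx_linear.

(* In the basis e, the space L^(A^* ) of the maps b |-> a * b. *)
Definition mult_space : {vspace 'M[K]_(\dim {:A})} := limg (linfun mult_mx).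

End Algebra.

(* Main.v *)
(** Everything is reduced to explicit linear maps between products of projective
   spaces and to evaluating multihomogeneous polynomials.

   A linear change of coordinates on each factor (possibly permuting the
   factors) that identifies two loci identifies the generic linear sections of
   their closures.  If A is Gorenstein with form G then L^A = L^(A^* ) G, so by
   Cauchy-Binet right multiplication by G is such a change of coordinates.  On
   the invertible elements of L^(A^* ) so is inversion, by Jacobi's formula for
   complementary minors, and it exchanges L_i and L_(n-i).

   The first term of the characteristic sequence is always 1: d general linear
   forms cut P(L) in one point of maximal rank, over which the closure of the
   graph has one point, since minors are polynomials in the entries.

   If A is not Gorenstein but L^A contains a form of corank 1 with kernel b0,
   then b0 is a common eigenvector of A, and there is an independent
   eigenvector b1 with the same character; so every corank 1 form has its
   kernel in W = <b0, b1>, and dim A >= 3.  The last factor of X_L therefore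
   lies on the conic of rank one symmetric tensors in S^2 W, which misses the
   intersection of two general hyperplanes, and d >= 2. *)

From HB Require Import structures.
Require Import Defs.
From mathcomp Require Import zify ring.
From mathcomp Require Import all_boot all_order all_fingroup all_algebra all_field.
From mathcomp Require Import boolp classical_sets reals complex mpoly.

Set Implicit Arguments.
Unset Strict Implicit.
Unset Printing Implicit Defensive.

Import Order.TTheory GRing.Theory Num.Theory.
(* Num.Theory also exports a char_num. *)
Import Defs.
Local Open Scope ring_scope.

(** * Nonvanishing of polynomials *)


(** No dimension theory is needed to make the counts exist. Both transfers identify the whole
    relation [general_num_points] on the two sides, so the numbers agree whether or not a count
    exists. A count is constructed only for the first term; for the last term every count is shown
    to be 0, which is also the default of [intersection_number]. The obstacle to the transfers is
    that the coordinates are redundant: minors of the matrices in a given space satisfy linear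
    relations, so the linear maps between the ambient products need not be invertible and are
    mutually inverse only on the loci. Since closures are cut out by multihomogeneous equations,
    facts about limit points are phrased as such equations. The kernel of the form of a functional
    is the largest ideal inside the kernel of that functional; when it is a line, all of the algebra
    acts on it by scalars, whence the common eigenvectors. Conversely a functional vanishes at some
    nonzero element of W, hence on the ideal it spans, and this traps every one-dimensional kernel
    in W. *)

Lemma horner_neq0 (K : numFieldType) (p : {poly K}) :
  p != 0 -> exists t, p.[t] != 0.
Proof.
move=> p0; apply: contrapT => /forallNP h.
(* In characteristic 0 the naturals below [size p] are distinct points, too many to be roots of
   [p]. *)
have rp : all (root p) [seq n%:R | n <- iota 0 (size p)].
  by apply/allP => x /mapP[k _ ->]; apply/negPn/negP => ?; exact: (h k%:R).
have /(max_poly_roots p0 rp) : uniq [seq n%:R : K | n <- iota 0 (size p)].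
  by rewrite map_inj_uniq ?iota_uniq // => i j /eqP; rewrite eqr_nat => /eqP.
by rewrite size_map size_iota ltnn.
Qed.

Lemma horner_eq0 (K : numFieldType) (p : {poly K}) :
  (forall t, p.[t] = 0) -> p = 0.
Proof.
by move=> h; apply/eqP/negP => /negP/horner_neq0[t]; rewrite h eqxx.
Qed.

(** Induction on the number of variables: [muni] reads [P] as a polynomial in the last variable,
    some point keeps its leading coefficient nonzero, and a nonzero univariate polynomial
    remains. *)
Lemma meval_neq0 (K : numFieldType) n (P : {mpoly K[n]}) :
  P != 0 -> exists v, P.@[v] != 0.
Proof.
elim: n P => [|n IHn] P P0.
  exists (fun=> 0); move: P0; apply: contra => /eqP.
  rewrite mevalE => h; rewrite [P]mpolyE; apply/eqP.
  rewrite big_seq big1 // => m mP; suff -> : P@_m = 0 by rewrite scale0r.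
  have mE (m' : 'X_{1.. 0}) : m' = m by apply/mnmP; case.
  move: h; rewrite (eq_big_seq (fun _ => P@_m)); last first.
    by move=> m' _; rewrite (mE m') big_ord0 mulr1.
  suff -> : (msupp P : seq _) = [:: m] by rewrite big_seq1.
  case: (msupp P : seq _) (msupp_uniq P) mP => // m1 [|m2 s] /=.
    by rewrite (mE m1).
  by rewrite (mE m1) (mE m2) inE eqxx.
pose wd (i : 'I_n) : 'I_n.+1 := widen_ord (leqnSn n) i.
pose low (m : 'X_{1.. n.+1}) := [multinom m (wd i) | i < n].
have evE w t : (map_poly (meval w) (muni P)).[t] =
    P.@[fun i => if unlift ord_max i is Some j then w j else t].
  rewrite muniE rmorph_sum horner_sum mevalE; apply: eq_bigr => m _.
  rewrite -!mul_polyC !rmorphM /= !map_polyC /= mevalZ mevalX map_polyXn.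
  rewrite hornerM hornerXn hornerC -mulrA; congr (_ * _).
  rewrite big_ord_recr /= unlift_none; congr (_ * _).
  apply: eq_bigr => i _; rewrite mnmE; case: unliftP => [j /(congr1 val)|/(congr1 val)] /=.
    rewrite /bump leqNgt (ltn_ord j) add0n => /val_inj -> //.
  by move=> h; have := ltn_ord i; rewrite h ltnn.
(* A monomial [m] of [P] is the only one that contributes to the coefficient of [low m] in degree
   [m ord_max]. *)
have U0 : muni P != 0.
  have [m mP] : exists m, m \in msupp P.
    case: (msupp P : seq _) (msupp_eq0 P) => [|m s _]; last by exists m; rewrite inE eqxx.
    by rewrite eqxx (negPf P0).
  apply: contraTneq mP => U0; rewrite mcoeff_msupp negbK.
  have : ((muni P)`_(m ord_max))@_(low m) = 0 by rewrite U0 coef0 mcoeff0.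
  rewrite muniE coef_sum raddf_sum /=.
  rewrite (eq_bigr (fun m' => if m' == m then P@_m else 0)); last first.
    move=> m' _; rewrite coefZ coefXn; case: (eqVneq m' m) => [->|ne].
      by rewrite eqxx mulr1 mcoeffZ mcoeffX eqxx mulr1.
    case: (eqVneq (m ord_max) (m' ord_max)) => [e|]; last by rewrite mulr0 mcoeff0.
    rewrite mulr1 mcoeffZ mcoeffX; case: eqP => [/mnmP e2|]; last by rewrite mulr0.
    case/eqP: ne; apply/mnmP => i.
    have [j ->|->] := unliftP ord_max i; last by rewrite e.
    have := e2 j; rewrite !mnmE; suff -> : lift ord_max j = wd j by [].
    by apply: val_inj; rewrite /= /bump leqNgt ltn_ord.
  rewrite -big_mkcond /= big_const_seq.
  case: (boolP (m \in msupp P)) => [mP|]; last by rewrite mcoeff_msupp negbK.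
  by rewrite count_uniq_mem ?msupp_uniq // mP /= addr0 => ->.
have [w w0] := IHn _ (eq_ind_r (fun b => is_true (~~ b)) U0 (lead_coef_eq0 _)).
have : map_poly (meval w) (muni P) != 0.
  apply: contra w0 => /eqP/(congr1 (fun p : {poly K} => p`_(size (muni P)).-1)).
  by rewrite coef_map coef0 => /eqP.
by case/horner_neq0 => t; rewrite evE => ht; eexists; exact: ht.
Qed.

(** * Polynomial and multihomogeneous functions *)


Section PolynomialFunctions.
Variables (K : fieldType) (F : finType) (T : F -> finType).
Implicit Types (x y : mvec K T) (f g : mvec K T -> K) (P : {mpoly K[#|{: mvar T}|]}).

(** Polynomials are handled through the functions they define, so that sums, products and
    determinants need no bookkeeping of variables. *)
Definition polyfun f := exists P, forall x, mvec_eval P x = f x.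

Lemma polyfun_ext f g : f =1 g -> polyfun f -> polyfun g.
Proof. by move=> e [P h]; exists P => x; rewrite h e. Qed.

Lemma polyfun_const c : polyfun (fun=> c).
Proof. by exists c%:MP => x; rewrite /mvec_eval mevalC. Qed.

Lemma polyfun_add f g : polyfun f -> polyfun g -> polyfun (fun x => f x + g x).
Proof.
by move=> [P h] [Q h']; exists (P + Q) => x; rewrite /mvec_eval mevalD -h -h'.
Qed.

Lemma polyfun_mul f g : polyfun f -> polyfun g -> polyfun (fun x => f x * g x).
Proof.
by move=> [P h] [Q h']; exists (P * Q) => x; rewrite /mvec_eval mevalM -h -h'.
Qed.

Lemma polyfun_coord j (t : T j) : polyfun (fun x => x j t).
Proof.
exists 'X_(enum_rank (Tagged T t)) => x.
by rewrite /mvec_eval mevalXU enum_rankK.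
Qed.

Lemma polyfun_sum I (r : seq I) (p : pred I) (f : I -> mvec K T -> K) :
  (forall i, polyfun (f i)) -> polyfun (fun x => \sum_(i <- r | p i) f i x).
Proof.
move=> h; elim: r => [|i r IHr].
  by apply: polyfun_ext (polyfun_const 0) => x; rewrite big_nil.
case pi: (p i); last by apply: polyfun_ext IHr => x; rewrite big_cons pi.
by apply: polyfun_ext (polyfun_add (h i) IHr) => x; rewrite big_cons pi.
Qed.

Lemma polyfun_prod I (r : seq I) (p : pred I) (f : I -> mvec K T -> K) :
  (forall i, polyfun (f i)) -> polyfun (fun x => \prod_(i <- r | p i) f i x).
Proof.
move=> h; elim: r => [|i r IHr].
  by apply: polyfun_ext (polyfun_const 1) => x; rewrite big_nil.
case pi: (p i); last by apply: polyfun_ext IHr => x; rewrite big_cons pi.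
by apply: polyfun_ext (polyfun_mul (h i) IHr) => x; rewrite big_cons pi.
Qed.

Lemma polyfun_det n (f : 'I_n -> 'I_n -> mvec K T -> K) :
  (forall i k, polyfun (f i k)) -> polyfun (fun x => \det (\matrix_(i, k) f i k x)).
Proof.
move=> h; apply: polyfun_sum => s; apply: polyfun_mul; first exact: polyfun_const.
by apply: polyfun_prod => i; move: (h i (s i)); apply: polyfun_ext => x; rewrite mxE.
Qed.

Lemma polyfun_exp f k : polyfun f -> polyfun (fun x => f x ^+ k).
Proof.
move=> h; have := @polyfun_prod _ (index_enum 'I_k) predT (fun=> f) (fun=> h).
by apply: polyfun_ext => x; rewrite prodr_const card_ord.
Qed.

Definition mdegs (deg : F -> nat) P := forall m, m \in msupp P ->
  forall j, (\sum_(k < #|{: mvar T}| | tag (enum_val k) == j) m k)%N = deg j.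

(** The multidegree is explicit because summands must share it; the zero function has every
    multidegree. *)
Definition mhomfun (deg : F -> nat) f :=
  exists2 P, mdegs deg P & forall x, mvec_eval P x = f x.

Lemma mhomfun_ext deg deg' f g :
  deg =1 deg' -> f =1 g -> mhomfun deg f -> mhomfun deg' g.
Proof.
move=> e e' [P dP h]; exists P => [m mP j|x]; last by rewrite h e'.
by rewrite -e dP.
Qed.

Lemma mhomfun0 deg : mhomfun deg (fun=> 0).
Proof.
by exists 0 => [m|x]; [rewrite msupp0 | rewrite /mvec_eval meval0].
Qed.

Lemma mhomfun_add deg f g :
  mhomfun deg f -> mhomfun deg g -> mhomfun deg (fun x => f x + g x).
Proof.
move=> [P dP h] [Q dQ h']; exists (P + Q) => [m /msuppD_le|x].
  by rewrite mem_cat => /orP[/dP|/dQ].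
by rewrite /mvec_eval mevalD -h -h'.
Qed.

Lemma mhomfunZ deg c f : mhomfun deg f -> mhomfun deg (fun x => c * f x).
Proof.
move=> [P dP h]; exists (c *: P) => [m /msuppZ_le/dP //|x].
by rewrite /mvec_eval mevalZ -h.
Qed.

Lemma mhomfun_const c : mhomfun (fun=> 0%N) (fun=> c).
Proof.
exists c%:MP => [m|x]; last by rewrite /mvec_eval mevalC.
rewrite msuppC; case: ifP => // _; rewrite inE => /eqP -> j.
by rewrite big1 // => k _; rewrite mnm0E.
Qed.

Lemma mhomfun_mul deg deg' f g : mhomfun deg f -> mhomfun deg' g ->
  mhomfun (fun j => deg j + deg' j)%N (fun x => f x * g x).
Proof.
move=> [P dP h] [Q dQ h']; exists (P * Q) => [m /msuppM_le|x]; last first.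
  by rewrite /mvec_eval mevalM -h -h'.
case/allpairsP=> -[m1 m2] /= [/dP d1 /dQ d2 ->] j.
by rewrite -d1 -d2 -big_split; apply: eq_bigr => k _; rewrite mnmDE.
Qed.

Lemma mhomfun_coord j (t : T j) :
  mhomfun (fun j' => nat_of_bool (j == j')) (fun x => x j t).
Proof.
exists 'X_(enum_rank (Tagged T t)) => [m|x]; last first.
  by rewrite /mvec_eval mevalXU enum_rankK.
rewrite msuppX inE => /eqP -> j'.
rewrite (eq_bigr (fun k => nat_of_bool (enum_rank (Tagged T t) == k))); last first.
  by move=> k _; rewrite mnm1E.
case: (eqVneq j j') => [<-|ne] /=.
  rewrite (bigD1 (enum_rank (Tagged T t))) ?enum_rankK //= eqxx big1 //.
  by move=> k /andP[_]; rewrite eq_sym => /negPf ->.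
rewrite big1 // => k /eqP e; case: eqP => // e'.
by move: e ne; rewrite -e' enum_rankK => /= ->; rewrite eqxx.
Qed.

Lemma mhomfun_sum deg I (r : seq I) (p : pred I) (f : I -> mvec K T -> K) :
  (forall i, p i -> mhomfun deg (f i)) ->
  mhomfun deg (fun x => \sum_(i <- r | p i) f i x).
Proof.
move=> h; elim: r => [|i r IHr].
  by apply: mhomfun_ext (mhomfun0 _) => // x; rewrite big_nil.
case pi: (p i); last by apply: mhomfun_ext IHr => // x; rewrite big_cons pi.
by apply: mhomfun_ext (mhomfun_add (h i pi) IHr) => // x; rewrite big_cons pi.
Qed.

Lemma mhomfun_prod I (r : seq I) (deg : I -> F -> nat) (f : I -> mvec K T -> K) :
  (forall i, mhomfun (deg i) (f i)) ->
  mhomfun (fun j => \sum_(i <- r) deg i j)%N (fun x => \prod_(i <- r) f i x).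
Proof.
move=> h; elim: r => [|i r IHr].
  by apply: mhomfun_ext (mhomfun_const 1) => x; rewrite big_nil.
by apply: mhomfun_ext (mhomfun_mul (h i) IHr) => x; rewrite big_cons.
Qed.

Lemma mhomfun_exp deg f k :
  mhomfun deg f -> mhomfun (fun j => k * deg j)%N (fun x => f x ^+ k).
Proof.
move=> h; have := @mhomfun_prod _ (index_enum 'I_k) _ (fun=> f) (fun=> h).
apply: mhomfun_ext => x; first by rewrite sum_nat_const card_ord.
by rewrite prodr_const card_ord.
Qed.

Lemma mhomfun_det deg n (f : 'I_n -> 'I_n -> mvec K T -> K) :
  (forall i k, mhomfun deg (f i k)) ->
  mhomfun (fun j => n * deg j)%N (fun x => \det (\matrix_(i, k) f i k x)).
Proof.
move=> h; apply: mhomfun_sum => s _; apply: mhomfunZ.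
apply: mhomfun_ext (mhomfun_prod (index_enum 'I_n) (fun i => h i (s i))) => x.
  by rewrite sum_nat_const card_ord.
by apply: eq_bigr => i _; rewrite mxE.
Qed.

(** Rescaling factor [j] by [c j] multiplies the value by the product of the [c j ^+ deg j]. *)
Lemma mhomfun_scale deg f x y :
  mhomfun deg f -> mproj_eq x y -> f x = 0 -> f y = 0.
Proof.
move=> [P dP h] e; rewrite -!h => Px.
have /boolp.choice[c ec] : forall j, exists c : K, y j = c *: x j.
  by move=> j; have [c _ ?] := e j; exists c.
suff -> : mvec_eval P y = (\prod_j c j ^+ deg j) * mvec_eval P x.
  by rewrite Px mulr0.
rewrite /mvec_eval !mevalE mulr_sumr big_seq [RHS]big_seq; apply: eq_bigr => m mP.
rewrite mulrCA; congr (_ * _).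
pose tg (k : 'I_#|{: mvar T}|) := tag (enum_val k).
rewrite (eq_bigr (fun k : 'I_#|{: mvar T}| => c (tg k) ^+ m k *
  x (tg k) (tagged (enum_val k)) ^+ m k)); last first.
  by move=> k _; rewrite ec ffunE exprMn.
rewrite big_split; congr (_ * _).
rewrite (partition_big tg predT) //=; apply: eq_bigr => j _.
rewrite -(dP m mP j) -prodrXr /=; apply: eq_bigr => k /eqP <- //.
Qed.

(** The main access to limit points: an identity on [S] passes to the closure once it is the
    vanishing of one multihomogeneous function. *)
Lemma zclosure_mhomfun (S : set (mvec K T)) deg f x :
  mhomfun deg f -> (forall y, S y -> f y = 0) -> zclosure S x -> f x = 0.
Proof.
move=> [P dP h] Sf [_ /(_ P) Sx]; rewrite -h; apply: Sx; first by exists deg.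
by move=> y /Sf; rewrite h.
Qed.

Lemma zclosure_incl (S : set (mvec K T)) x :
  S x -> mproj_point x -> zclosure S x.
Proof. by move=> Sx px; split=> // P _; exact. Qed.

Lemma mproj_eq_sym x y : mproj_eq x y -> mproj_eq y x.
Proof.
move=> e j; have [c c0 ->] := e j; exists c^-1; first by rewrite invr_eq0.
by rewrite scalerA mulVf // scale1r.
Qed.

Lemma mproj_eq_trans x y z : mproj_eq x y -> mproj_eq y z -> mproj_eq x z.
Proof.
move=> e e' j; have [c c0 Ey] := e j; have [c' c'0 ->] := e' j.
by exists (c' * c); rewrite ?mulf_neq0 // Ey scalerA.
Qed.

Lemma zclosure_mproj_eq (S : set (mvec K T)) x y :
  mproj_eq x y -> zclosure S x -> zclosure S y.
Proof.
move=> e [px Sx]; split=> [j|P [deg dP] SP].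
  by have [c c0 ->] := e j; rewrite scaler_eq0 negb_or c0 px.
apply: (@mhomfun_scale deg (mvec_eval P) x) => //; first by exists P.
by apply: Sx => //; exists deg.
Qed.

End PolynomialFunctions.

Lemma polyfun_comp (K : fieldType) (F F' : finType) (T : F -> finType)
    (T' : F' -> finType) (f : mvec K T' -> K) (psi : mvec K T -> mvec K T') :
  (forall j t, polyfun (fun x => psi x j t)) -> polyfun f ->
  polyfun (f \o psi).
Proof.
move=> h [P fE]; suff : polyfun (fun x => mvec_eval P (psi x)).
  by apply: polyfun_ext => x; rewrite fE.
rewrite /mvec_eval.
apply: (@polyfun_ext _ _ _ (fun x => \sum_(m <- msupp P) P@_m *
  \prod_i psi x (tag (enum_val i)) (tagged (enum_val i)) ^+ m i)).
  by move=> x; rewrite mevalE.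
apply: polyfun_sum => m; apply: polyfun_mul; first exact: polyfun_const.
by apply: polyfun_prod => i; apply: polyfun_exp; apply: h.
Qed.

Lemma mhomfun_comp (K : fieldType) (F F' : finType) (T : F -> finType)
    (T' : F' -> finType) (psi : mvec K T -> mvec K T') (rho : F' -> F -> nat)
    deg (f : mvec K T' -> K) :
  (forall j t, mhomfun (rho j) (fun x => psi x j t)) -> mhomfun deg f ->
  mhomfun (fun j => \sum_j' deg j' * rho j' j)%N (f \o psi).
Proof.
move=> h [P dP fE]; suff : mhomfun (fun j => \sum_j' deg j' * rho j' j)%N
   (fun x => mvec_eval P (psi x)).
  by apply: mhomfun_ext => x //; rewrite fE.
apply: (@mhomfun_ext _ _ _ (fun j => \sum_j' deg j' * rho j' j)%N _
  (fun x => \sum_(m <- msupp P | m \in msupp P) P@_m *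
  \prod_i psi x (tag (enum_val i)) (tagged (enum_val i)) ^+ m i)) => //.
  by move=> x; rewrite -big_seq /mvec_eval mevalE.
apply: mhomfun_sum => m mP; apply: mhomfunZ.
apply: mhomfun_ext (mhomfun_prod (index_enum _)
  (fun i => mhomfun_exp (m i) (h _ (tagged (enum_val i))))) => // j.
rewrite (partition_big (fun k => tag (enum_val k)) predT) //=.
apply: eq_bigr => j' _; rewrite -(dP m mP j') big_distrl /=.
by apply: eq_bigr => k /eqP ->.
Qed.

(** * Linear maps and generic linear sections *)


Section GenericPoint.
Variables (K : numFieldType) (F : finType) (T : F -> finType).

Lemma mvec_eval_neq0 (G : {mpoly K[#|{: mvar T}|]}) :
  G != 0 -> exists x : mvec K T, mvec_eval G x != 0.
Proof.
case/meval_neq0 => v v0.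
exists (fun j => [ffun t => v (enum_rank (Tagged T t))]).
rewrite /mvec_eval (_ : meval _ _ = G.@[v]) //; apply: meval_eq => k.
by rewrite ffunE; case: (enum_val k) (enum_valK k) => j t /= ->.
Qed.

Lemma mvec_eval_neq0_poly (G : {mpoly K[#|{: mvar T}|]}) (x : mvec K T) :
  mvec_eval G x != 0 -> G != 0.
Proof. by apply: contraNneq => ->; rewrite /mvec_eval meval0. Qed.

(** Multiplying [G] by one coordinate of each factor forces every component of the point to be
    nonzero. *)
Lemma mproj_point_eval_neq0 (G : {mpoly K[#|{: mvar T}|]}) :
  (forall j, T j) -> G != 0 ->
  exists2 x : mvec K T, mproj_point x & mvec_eval G x != 0.
Proof.
move=> t0 G0; pose D := \prod_j 'X_(enum_rank (Tagged T (t0 j))) : {mpoly K[#|{: mvar T}|]}.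
have D0 : D != 0 by apply/prodf_neq0 => j _; rewrite -msupp_eq0 msuppX.
have [x] := mvec_eval_neq0 (mulf_neq0 G0 D0).
rewrite /mvec_eval mevalM mulf_eq0 negb_or => /andP[Gx Dx]; exists x => // j.
move: Dx; rewrite rmorph_prod => /prodf_neq0 /(_ j isT) /=.
by rewrite mevalXU enum_rankK /=; apply: contra => /eqP ->; rewrite ffunE.
Qed.

End GenericPoint.

Lemma existT_cast_ord (F : Type) (b : F -> nat) i j (eij : i = j)
    (e : b j = b i) (k : 'I_(b j)) :
  existT (fun j => 'I_(b j)) i (cast_ord e k) = existT _ j k.
Proof. by case: j / eij e k => e k; rewrite cast_ord_id. Qed.

Lemma extend_family (K : fieldType) (F : finType) (T : F -> finType) (i : F)
    (a : T i -> K) :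
  exists a' : forall j, T j -> K, forall t, a' i t = a t.
Proof.
exists (fun j t => if pselect (j = i) is left e then a (ecast k (T k) e t) else 0).
by move=> t; case: pselect => // e; rewrite (eq_irrelevance e erefl).
Qed.

Section Transfer.
Variables (K : numFieldType) (F : finType) (sg : F -> F).
Hypothesis sgK : involutive sg.

(** Only the entries with [j = sg j'] matter. Allowing every [j] lets [sg (sg j) = j] be rewritten
    without transporting coefficients between types. *)
Definition coefs (T T' : F -> finType) := forall j', T' j' -> forall j, T j -> K.

Definition linmap (T T' : F -> finType) (A : coefs T T') (x : mvec K T) : mvec K T' :=
  fun j' => [ffun t' => \sum_(t : T (sg j')) A j' t' (sg j') t * x (sg j') t].

Lemma mhomfun_linmap T T' (A : coefs T T') j' t' :
  mhomfun (fun j => nat_of_bool (sg j' == j)) (fun x => linmap A x j' t').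
Proof.
apply: (@mhomfun_ext _ _ _ (fun j => nat_of_bool (sg j' == j)) _
  (fun x => \sum_(t : T (sg j')) A j' t' (sg j') t * x (sg j') t)) => //.
  by move=> x; rewrite ffunE.
by apply: mhomfun_sum => t _; apply: mhomfunZ; apply: mhomfun_coord.
Qed.

Lemma mproj_eq_linmap T T' (A : coefs T T') x y :
  mproj_eq x y -> mproj_eq (linmap A x) (linmap A y).
Proof.
move=> e j; have [c c0 yE] := e (sg j); exists c => //.
apply/ffunP => t; rewrite !ffunE scaler_sumr; apply: eq_bigr => t' _.
by rewrite yE ffunE [RHS]mulrCA.
Qed.

(** The second condition is an equality of vectors, not of projective points: it is thus linear in
    the coordinates and extends to the closure. *)
Definition mutually_inverse (T T' : F -> finType) (A : coefs T T') (B : coefs T' T)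
    (S : set (mvec K T)) (S' : set (mvec K T')) :=
  forall y, S y -> zclosure S' (linmap A y) /\ linmap B (linmap A y) = y.

Section OneDirection.
Variables (T T' : F -> finType) (A : coefs T T') (B : coefs T' T).
Variables (S : set (mvec K T)) (S' : set (mvec K T')).
Hypothesis AB : mutually_inverse A B S S'.

Lemma linmapK_zclosure x : zclosure S x -> linmap B (linmap A x) = x.
Proof.
move=> Sx; apply: functional_extensionality_dep => j; apply/ffunP => t.
apply/eqP; rewrite -subr_eq0; apply/eqP.
apply: (@zclosure_mhomfun _ _ _ S (fun j' => nat_of_bool (j == j'))
  (fun x => linmap B (linmap A x) j t - x j t)) => //; last first.
  by move=> y /AB[_ ->]; rewrite subrr.
apply: mhomfun_add.
  have := mhomfun_comp (@mhomfun_linmap _ _ A) (mhomfun_linmap B t).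
  apply: mhomfun_ext => // j'.
  rewrite (bigD1 (sg j)) //= eqxx mul1n sgK big1 ?addn0 // => i.
  by rewrite eq_sym => /negPf ->.
have := mhomfunZ (-1) (@mhomfun_coord K _ _ _ t).
by apply: mhomfun_ext => // y; rewrite mulN1r.
Qed.

Lemma linmap_zclosure x : zclosure S x -> zclosure S' (linmap A x).
Proof.
move=> Sx; split=> [j|P [deg dP] SP].
  (* A zero component [j] of the image would, after applying [B], give a zero component [sg j] of
     [x]. *)
  apply/eqP => Ax0; case: (Sx) => /(_ (sg j))/eqP nz _; apply: nz.
  rewrite -{1}(linmapK_zclosure Sx); apply/ffunP => t; rewrite !ffunE.
  have A0 : linmap A x (sg (sg j)) = 0 by rewrite sgK.
  by rewrite big1 // => t' _; rewrite A0 ffunE mulr0.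
have mP : mhomfun deg (mvec_eval P) by exists P.
apply: (zclosure_mhomfun (mhomfun_comp (@mhomfun_linmap _ _ A) mP) _ Sx).
by move=> y /AB[[_ h] _]; apply: h => //; exists deg.
Qed.

End OneDirection.

(** * Linear forms pulled back along linear maps *)

Definition lineval (T : F -> finType) (b : F -> nat) (h : hyps K T b)
    (x : mvec K T) (s : {j : F & 'I_(b j)}) : K :=
  \sum_(t : T (tag s)) h s t * x (tag s) t.

Section Hyperplanes.
Variable b : F -> nat.

Definition up (s : {j : F & 'I_((b \o sg) j)}) : {j : F & 'I_(b j)} :=
  Tagged (fun j => 'I_(b j)) (tagged s : 'I_(b (sg (tag s)))).

Definition down (s : {j : F & 'I_(b j)}) : {j : F & 'I_((b \o sg) j)} :=
  Tagged (fun j => 'I_((b \o sg) j))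
    (cast_ord (congr1 b (esym (sgK (tag s)))) (tagged s)).

Lemma upK s : down (up s) = s.
Proof.
case: s => j k; exact: (@existT_cast_ord _ (b \o sg)) (sgK j) _ _.
Qed.

Lemma downK s : up (down s) = s.
Proof.
case: s => j k; exact: existT_cast_ord (sgK j) _ _.
Qed.

(** This and [push] are the transposes of [linmap A] and [linmap B], acting on tuples of linear
    forms. *)
Definition pull T T' (A : coefs T T') (h : hyps K T' (b \o sg)) : hyps K T b :=
  fun s => [ffun t => \sum_(t' : T' (sg (tag s)))
              h (down s) t' * A (sg (tag s)) t' (tag s) t].

Definition push T T' (B : coefs T' T) (h : hyps K T b) : hyps K T' (b \o sg) :=
  fun s => [ffun t' => \sum_(t : T (sg (tag s)))
              h (up s) t * B (sg (tag s)) t (tag s) t'].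

Lemma lineval_pull T T' (A : coefs T T') h x s :
  lineval (pull A h) x s = lineval h (linmap A x) (down s).
Proof.
rewrite /lineval /=.
under eq_bigr => t _ do rewrite ffunE mulr_suml.
rewrite exchange_big /=; apply: eq_bigr => t' _; rewrite ffunE.
pose f j := \sum_(t : T j) h (down s) t' * A (sg (tag s)) t' j t * x j t.
rewrite -[LHS]/(f (tag s)) -[in LHS](sgK (tag s)) /f mulr_sumr.
by apply: eq_bigr => t _; rewrite mulrA.
Qed.

Lemma lineval_push T T' (B : coefs T' T) h x s :
  lineval (push B h) x s = lineval h (linmap B x) (up s).
Proof.
rewrite /lineval /=.
under eq_bigr => t _ do rewrite ffunE mulr_suml.
rewrite exchange_big /=; apply: eq_bigr => t' _; rewrite ffunE.
pose f j := \sum_(t : T' j) h (up s) t' * B (sg (tag s)) t' j t * x j t.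
rewrite -[LHS]/(f (tag s)) -[in LHS](sgK (tag s)) /f mulr_sumr.
by apply: eq_bigr => t _; rewrite mulrA.
Qed.

End Hyperplanes.

(** Linear forms [h] on the target become forms [Q h] on the source with corresponding sections, so
    the open condition [G] is pulled back along [Q]. *)
Lemma general_num_points_transfer (T T' : F -> finType) (A : coefs T T')
    (B : coefs T' T) S S' (b : F -> nat) c :
  mutually_inverse A B S S' -> mutually_inverse B A S' S -> (forall j, T j) ->
  general_num_points b (zclosure S) c ->
  general_num_points (b \o sg) (zclosure S') c.
Proof.
move=> AB BA t0 [G G0 Gc].
have [|g pg Gg] := mproj_point_eval_neq0 _ G0; first by move=> s; exact: t0.
have u s : {t | g s t != 0}.
  apply: cid; apply: contrapT => /forallNP h; case/eqP: (pg s).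
  by apply/ffunP => t; rewrite ffunE; apply/eqP/negPn/negP; apply: h.
(* [pull A] need not be onto.  Adding [kap], which vanishes on the closure of
   [S], does not change the sections, and [Q] takes the value [g]. *)
pose kap : hyps K T b := fun s => [ffun t => g s t - pull A (push B g) s t].
pose Q h : hyps K T b := fun s => pull A h s + kap s.
have QE x h s : zclosure S x ->
    lineval (Q h) x s = lineval h (linmap A x) (down s).
  move=> Sx; rewrite -lineval_pull /lineval.
  under eq_bigr => t _ do rewrite ffunE mulrDl.
  rewrite big_split /= [X in _ + X](_ : _ = 0) ?addr0 //.
  under eq_bigr => t _ do rewrite /kap ffunE mulrBl.
  rewrite sumrB; apply/eqP; rewrite subr_eq0; apply/eqP.
  rewrite -[LHS]/(lineval g x s) -[X in _ = X]/(lineval (pull A (push B g)) x s).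
  rewrite lineval_pull lineval_push downK (linmapK_zclosure AB) //.
have Qpoly s t : polyfun (fun h => Q h s t).
  apply: (@polyfun_ext _ _ _ (fun h : hyps K T' (b \o sg) => \sum_(t' : T' (sg (tag s)))
              h (down s) t' * A (sg (tag s)) t' (tag s) t + kap s t)).
    by move=> h; rewrite !ffunE.
  apply: polyfun_add; last exact: polyfun_const.
  apply: polyfun_sum => t'; apply: polyfun_mul; last exact: polyfun_const.
  exact: polyfun_coord.
(* The extra product, over coordinates where [g] is nonzero, keeps each form of [Q h] nonzero, as
   the hypothesis on [G] requires. *)
have [G' G'E] : polyfun (fun h => mvec_eval G (Q h) * \prod_s Q h s (sval (u s))).
  apply: polyfun_mul; last by apply: polyfun_prod.
  by apply: (@polyfun_comp _ _ _ _ _ (mvec_eval G) Q) => //; exists G.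
exists G'.
  apply: contraTneq (isT : true) => G'0.
  have := G'E (push B g); rewrite G'0 /mvec_eval meval0 => /esym/eqP.
  have -> : Q (push B g) = g.
    apply: functional_extensionality_dep => s; apply/ffunP => t.
    by rewrite /Q /kap ffunE [in X in _ + X]ffunE addrC subrK.
  rewrite mulf_eq0 (negPf Gg) /= => /prodf_eq0[s _].
  by rewrite (negPf (svalP (u s))).
move=> h ph; rewrite G'E mulf_eq0 negb_or => /andP[GQ /prodf_neq0 uQ].
have [|p [Sp injp surp]] := Gc (Q h) _ GQ.
  by move=> s; apply: contra (uQ s isT) => /eqP ->; rewrite ffunE.
exists (fun k => linmap A (p k)); split=> [k|k l e|x [Sx hx]].
- have [Sk hk] := Sp k; split; first exact: (linmap_zclosure AB).
  move=> s; rewrite -[s]upK -[LHS]/(lineval h (linmap A (p k)) (down (up s))).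
  by rewrite -QE //; apply: hk.
- apply: injp; rewrite -(linmapK_zclosure AB (proj1 (Sp k))).
  rewrite -(linmapK_zclosure AB (proj1 (Sp l))); exact: mproj_eq_linmap.
- have SBx := linmap_zclosure BA Sx.
  have [|k ek] := surp (linmap B x).
    split=> // s; rewrite -[LHS]/(lineval (Q h) (linmap B x) s) QE //.
    by rewrite (linmapK_zclosure BA) //; apply: hx.
  by exists k; rewrite -(linmapK_zclosure BA Sx); apply: mproj_eq_linmap.
Qed.

(** The two sets of generic counts are equal, so [xget] returns the same value even if both are
    empty. *)
Lemma intersection_number_transfer (T T' : F -> finType) (A : coefs T T')
    (B : coefs T' T) S S' (b : F -> nat) :
  mutually_inverse A B S S' -> mutually_inverse B A S' S ->
  (forall j, T j) -> (forall j, T' j) ->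
  intersection_number b (zclosure S) = intersection_number (b \o sg) (zclosure S').
Proof.
move=> AB BA t0 t0'; rewrite /intersection_number; congr xget.
apply/seteqP; split=> c /=; first exact: (general_num_points_transfer AB BA).
move/(general_num_points_transfer BA AB t0').
by rewrite (_ : (b \o sg) \o sg = b) //; apply: funext => j /=; rewrite sgK.
Qed.

Lemma linmap_of_functionals (X : Type) (E : set X) (T T' : F -> finType)
    (phi : X -> mvec K T) (psi : X -> mvec K T') :
  (forall j t', exists a : T (sg j) -> K, forall x, E x ->
     psi x j t' = \sum_t a t * phi x (sg j) t) ->
  exists A : coefs T T', forall x, E x -> linmap A (phi x) = psi x.
Proof.
move=> h.
have h' j (t' : T' j) : {a : forall j, T j -> K | forall x, E x ->
    psi x j t' = \sum_t a (sg j) t * phi x (sg j) t}.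
  apply: cid; have [a aE] := h j t'; have [a' a'E] := extend_family a.
  by exists a' => x /aE ->; apply: eq_bigr => t _; rewrite a'E.
exists (fun j t' => sval (h' j t')) => x Ex.
apply: functional_extensionality_dep => j; apply/ffunP => t'.
by rewrite ffunE (svalP (h' j t')).
Qed.

Lemma linmapZ (T T' : F -> finType) (A : coefs T T') (c : K) x :
  linmap A (fun j => c *: x j) = fun j => c *: linmap A x j.
Proof.
apply: functional_extensionality_dep => j; apply/ffunP => t.
by rewrite !ffunE scaler_sumr; apply: eq_bigr => s _; rewrite ffunE [RHS]mulrCA.
Qed.

(** The scalars [c] and [c'] let a map be linear only after clearing a denominator; for inversion
    both are the determinant. *)
Lemma mutually_inverse_param (X X' : Type) (E : set X) (E' : set X')
    (T T' : F -> finType) (phi : X -> mvec K T) (phi' : X' -> mvec K T')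
    (A : coefs T T') (B : coefs T' T) u v c c' :
  (forall x, E' x -> mproj_point (phi' x)) ->
  (forall x, E x -> [/\ E' (u x), v (u x) = x & c x * c' (u x) = 1]) ->
  (forall x, E x -> linmap A (phi x) = fun j => c x *: phi' (u x) j) ->
  (forall x, E' x -> linmap B (phi' x) = fun j => c' x *: phi (v x) j) ->
  mutually_inverse A B (phi @` E) (phi' @` E').
Proof.
move=> pE' uE AE BE _ [x Ex <-]; have [E'u vu cc] := uE _ Ex; rewrite AE //; split.
  apply: (@zclosure_mproj_eq _ _ _ _ (phi' (u x))).
    move=> j; exists (c x) => //.
    by apply/negP => /eqP c0; move/eqP: cc; rewrite c0 mul0r eq_sym oner_eq0.
  by apply: zclosure_incl; [exists (u x) | apply: pE'].
rewrite linmapZ BE // vu; apply: functional_extensionality_dep => j.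
by rewrite scalerA cc scale1r.
Qed.

Lemma intersection_number_param (X X' : Type) (E : set X) (E' : set X')
    (T T' : F -> finType) (phi : X -> mvec K T) (phi' : X' -> mvec K T') u v c c' b :
  (forall j, T j) -> (forall j, T' j) ->
  (forall x, E x -> mproj_point (phi x)) ->
  (forall x, E' x -> mproj_point (phi' x)) ->
  (forall x, E x -> [/\ E' (u x), v (u x) = x & c x * c' (u x) = 1]) ->
  (forall x, E' x -> [/\ E (v x), u (v x) = x & c' x * c (v x) = 1]) ->
  (forall j t, exists a : T (sg j) -> K, forall x, E x ->
     c x * phi' (u x) j t = \sum_s a s * phi x (sg j) s) ->
  (forall j t, exists a : T' (sg j) -> K, forall x, E' x ->
     c' x * phi (v x) j t = \sum_s a s * phi' x (sg j) s) ->
  intersection_number b (zclosure (phi @` E)) =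
  intersection_number (b \o sg) (zclosure (phi' @` E')).
Proof.
move=> t0 t0' pE pE' uE vE' hA hB.
have [|A AE] := @linmap_of_functionals _ E _ _ phi (fun x j => c x *: phi' (u x) j).
  by move=> j t; have [a aE] := hA j t; exists a => x /aE <-; rewrite ffunE.
have [|B BE] := @linmap_of_functionals _ E' _ _ phi' (fun x j => c' x *: phi (v x) j).
  by move=> j t; have [a aE] := hB j t; exists a => x /aE <-; rewrite ffunE.
apply: (@intersection_number_transfer _ _ A B) => //.
  exact: (mutually_inverse_param pE' uE AE BE).
exact: (mutually_inverse_param pE vE' BE AE).
Qed.

End Transfer.

(** * Minors *)


Section Minors.
Variables (K : fieldType) (n : nat).
Implicit Types M : 'M[K]_n.

Lemma sort_injection i (f : 'I_i -> 'I_n) : injective f ->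
  exists (I : minor_idx n i) (s : 'S_i), forall a, f a = val I (s a).
Proof.
move=> injf; pose t := [tuple of map f (ord_tuple i)].
have [s ts] : exists s : 'S_i,
    t = [tuple tnth (sort_tuple (fun x y : 'I_n => x <= y)%N t) (s a) | a < i].
  have /tuple_permP[s sE] : perm_eq t (sort_tuple (fun x y : 'I_n => x <= y)%N t).
    by rewrite perm_sym perm_sort.
  by exists s; apply: val_inj.
pose g := [ffun a => tnth (sort_tuple (fun x y : 'I_n => x <= y)%N t) a].
have st : sorted ltn (map val (sort (fun x y : 'I_n => x <= y)%N t)).
  rewrite ltn_sorted_uniq_leq map_inj_uniq; last exact: val_inj.
  rewrite sort_uniq map_inj_uniq // val_ord_tuple enum_uniq /=.
  by rewrite sorted_map; apply: sort_sorted => x y; exact: leq_total.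
have gP : [forall a : 'I_i, forall b : 'I_i, (a < b)%N ==> (g a < g b)%N].
  apply/forallP => a; apply/forallP => b; apply/implyP => ab.
  have sz (c : 'I_i) : (c < size (sort (fun x y : 'I_n => x <= y)%N t))%N.
    by rewrite size_tuple ltn_ord.
  have x0 : 'I_n := f a.
  rewrite !ffunE !(tnth_nth x0) /= -!(nth_map x0 0%N val) ?sz //.
  by rewrite (sorted_ltn_nth ltn_trans) // inE size_map sz.
exists (exist _ g gP), s => a; rewrite /= ffunE.
have <- : tnth t a = f a by rewrite tnth_map tnth_ord_tuple.
by rewrite {1}ts tnth_mktuple.
Qed.

Lemma minor_idx_inj i (I : minor_idx n i) : injective (val I).
Proof.
case: I => f /= /forallP fP a b fab; apply/val_inj/eqP.
case: ltngtP => // ab.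
  by have /forallP/(_ b)/implyP/(_ ab) := fP a; rewrite fab ltnn.
by have /forallP/(_ a)/implyP/(_ ab) := fP b; rewrite fab ltnn.
Qed.

Lemma det_mxsub_perm i (f g f' g' : 'I_i -> 'I_n) (s t : 'S_i) M :
  (forall a, f a = f' (s a)) -> (forall a, g a = g' (t a)) ->
  \det (mxsub f g M) = (-1) ^+ s * (-1) ^+ t * \det (mxsub f' g' M).
Proof.
move=> fE gE; rewrite (_ : mxsub f g M = row_perm s (col_perm t (mxsub f' g' M))).
  by rewrite row_permE col_permE !det_mulmx !det_perm odd_permV mulrA mulrAC.
by apply/matrixP => a b; rewrite !mxE fE gE.
Qed.

Lemma det_mxsub_ninj i (f g : 'I_i -> 'I_n) M :
  ~ injective f -> \det (mxsub f g M) = 0.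
Proof.
move=> ninj; have [a [b [ab fab]]] : exists a b, a != b /\ f a = f b.
  apply: contrapT => h; apply: ninj => a b fab; apply/eqP/negPn/negP => ab.
  by apply: h; exists a, b.
by apply: (determinant_alternate ab) => c; rewrite !mxE fab.
Qed.

(** Sorting the row and column choices gives a signed minor, and a repeated index gives 0; the
    coefficients do not depend on [M]. *)
Lemma det_mxsubE i (f g : 'I_i -> 'I_n) :
  exists a : minor_idx n i * minor_idx n i -> K,
    forall M, \det (mxsub f g M) = \sum_p a p * minor p.1 p.2 M.
Proof.
have [fi|fn] := pselect (injective f); last first.
  by exists (fun=> 0) => M; rewrite det_mxsub_ninj // big1 // => p; rewrite mul0r.
have [gi|gn] := pselect (injective g); last first.
  exists (fun=> 0) => M; rewrite -det_tr trmx_mxsub det_mxsub_ninj //.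
  by rewrite big1 // => p; rewrite mul0r.
have [I [s fE]] := sort_injection fi; have [J [t gE]] := sort_injection gi.
exists (fun p => if p == (I, J) then (-1) ^+ s * (-1) ^+ t else 0) => M.
rewrite (bigD1 (I, J)) //= eqxx big1 ?addr0 => [|p /negPf ->]; last by rewrite mul0r.
exact: det_mxsub_perm.
Qed.

(** Cauchy-Binet before grouping: the sum runs over all maps, not only the increasing ones. *)
Lemma det_mxsub_mull i (f g : 'I_i -> 'I_n) (A M : 'M[K]_n) :
  \det (mxsub f g (A *m M)) =
  \sum_(h : {ffun 'I_i -> 'I_n}) (\prod_a A (f a) (h a)) * \det (mxsub h g M).
Proof.
rewrite /determinant.
under [RHS]eq_bigr => h _ do rewrite mulr_sumr.
rewrite exchange_big /=; apply: eq_bigr => s _.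
under [RHS]eq_bigr => h _ do rewrite mulrCA.
rewrite -mulr_sumr; congr (_ * _).
under eq_bigr => a _ do rewrite !mxE.
rewrite bigA_distr_bigA /=; apply: eq_bigr => h _; rewrite -big_split /=.
by apply: eq_bigr => a _; rewrite !mxE.
Qed.

Lemma det_mxsub_mulr i (f g : 'I_i -> 'I_n) (A M : 'M[K]_n) :
  \det (mxsub f g (M *m A)) =
  \sum_(h : {ffun 'I_i -> 'I_n}) (\prod_a A (h a) (g a)) * \det (mxsub f h M).
Proof.
rewrite -det_tr trmx_mxsub trmx_mul det_mxsub_mull; apply: eq_bigr => h _.
rewrite -det_tr trmx_mxsub trmxK; congr (_ * _).
by apply: eq_bigr => a _; rewrite mxE.
Qed.

Lemma mxsub_mulmx m p (f : 'I_m -> 'I_n) (g : 'I_p -> 'I_n) M :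
  mxsub f g M = rowsub f 1%:M *m M *m colsub g 1%:M.
Proof. by rewrite mul_rowsub_mx mul1mx mulmx_colsub mulmx1 -mxsub_comp. Qed.

Lemma mxrank_mxsub m p (f : 'I_m -> 'I_n) (g : 'I_p -> 'I_n) M :
  (\rank (mxsub f g M) <= \rank M)%N.
Proof.
by rewrite mxsub_mulmx (leq_trans (mxrankM_maxl _ _)) // mxrankM_maxr.
Qed.

Lemma minor_neq0_rank i (I J : minor_idx n i) M :
  minor I J M != 0 -> (i <= \rank M)%N.
Proof.
rewrite -unitfE -[_ \is a _]/(_ \in unitmx) => /mxrank_unit <-.
exact: mxrank_mxsub.
Qed.

(** Take [i] rows out of a maximal independent family, then [i] columns on which these rows stay
    independent. *)
Lemma rank_minor_neq0 i M : (i <= \rank M)%N ->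
  exists (I J : minor_idx n i), minor I J M != 0.
Proof.
move=> iM; pose f a := maxrankfun M (widen_ord iM a).
have ffree : row_free (rowsub f M).
  have := maxrowsub_free M; rewrite -!kermx_eq0 => /eqP k0.
  apply/rowV0P => v /sub_kermxP vf.
  pose w := v *m rowsub (widen_ord iM) 1%:M.
  have w0 : w *m rowsub (maxrankfun M) M = 0.
    rewrite -mulmxA mul_rowsub_mx mul1mx -mxsub_comp; exact: vf.
  have {}w0 : w = 0.
    by apply/eqP; rewrite -submx0 -k0; apply/sub_kermxP.
  apply/rowP => a; rewrite mxE.
  move/rowP: w0 => /(_ (widen_ord iM a)); rewrite !mxE => <-.
  rewrite (bigD1 a) //= !mxE eqxx mulr1 big1 ?addr0 // => b ba.
  by rewrite !mxE -val_eqE /= (negPf ba : (b == a :> nat) = false) mulr0.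
have cfull : row_full (rowsub f M)^T by rewrite /row_full mxrank_tr; exact: ffree.
pose g := fullrankfun cfull.
have : \det (mxsub f g M) != 0.
  rewrite -unitfE -[_ \is a _]/(_ \in unitmx) -unitmx_tr.
  rewrite (_ : _^T = rowsub g (rowsub f M)^T) ?fullrowsub_unit //.
  by apply/matrixP => a b; rewrite !mxE.
have [fi|fn] := pselect (injective f); last first.
  by rewrite det_mxsub_ninj // eqxx.
have [gi|gn] := pselect (injective g); last first.
  by rewrite -det_tr trmx_mxsub det_mxsub_ninj // eqxx.
have [I [s fE]] := sort_injection fi; have [J [t gE]] := sort_injection gi.
rewrite (det_mxsub_perm _ fE gE) !mulf_eq0 !negb_or => /andP[_ IJ].
by exists I, J.
Qed.

End Minors.

(** * Complementary minors of an inverse matrix *)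

Lemma extend_injection i m (f : 'I_i -> 'I_(i + m)) : injective f ->
  exists s : 'S_(i + m), forall a, s (lshift m a) = f a.
Proof.
move=> fi; pose C := [set x | x \notin codom f]%SET.
have cC : #|C| = m.
  have := cardC (mem (codom f)); rewrite card_codom // !card_ord.
  by move=> /addnI cm; rewrite -[RHS]cm; apply: eq_card => x; rewrite !inE.
pose h x := match split x with inl a => f a
  | inr b => enum_val (cast_ord (esym cC) b) end.
have hi : injective h.
  move=> x y; rewrite /h; case: splitP => a xa; case: splitP => b yb e.
  - by apply: val_inj; rewrite /= xa yb (fi _ _ e).
  - by have := enum_valP (cast_ord (esym cC) b); rewrite -e inE codom_f.
  - by have := enum_valP (cast_ord (esym cC) a); rewrite e inE codom_f.
  - by apply: val_inj; rewrite /= xa yb; move/enum_val_inj/cast_ord_inj: e => ->.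
exists (perm hi) => a; rewrite permE /h; case: splitP => [b|b] /= e.
  by congr f; apply: val_inj.
by have := ltn_ord a; rewrite e ltnNge leq_addr.
Qed.


Lemma det_mxsub_invmx (K : fieldType) n i m (f g : 'I_i -> 'I_n) :
  (i + m)%N = n -> injective f -> injective g ->
  exists (f' g' : 'I_m -> 'I_n) (c : K), forall M : 'M[K]_n, M \in unitmx ->
    \det M * \det (mxsub f g (invmx M)) = c * \det (mxsub g' f' M).
Proof.
move=> E; case: n / E f g => f g fi gi.
(* Permutations bring the chosen rows and columns to the front. They swap sides between [M] and its
   inverse, so that the permuted matrices stay inverse to each other. *)
have [s sE] := extend_injection fi; have [t tE] := extend_injection gi.
exists (fun a => s (rshift i a)), (fun a => t (rshift i a)),
  ((-1) ^+ s * (-1) ^+ t) => M uM.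
pose M' := mxsub t s M; pose N := mxsub s t (invmx M).
have MN : M' *m N = 1%:M.
  apply/matrixP => a b; rewrite !mxE (reindex_inj (@perm_inj _ s^-1%g)) /=.
  have /matrixP/(_ (t a) (t b)) := mulmxV uM; rewrite !mxE (inj_eq perm_inj) => <-.
  by apply: eq_bigr => c _; rewrite !mxE permKV.
have detM' : \det M' = (-1) ^+ s * (-1) ^+ t * \det M.
  by rewrite /M' (@det_mxsub_perm _ _ _ t s id id t s) // mxsub_id [_ ^+ t * _]mulrC.
have ulN : ulsubmx N = mxsub f g (invmx M).
  by apply/matrixP => a b; rewrite !mxE sE tE.
have drM : drsubmx M' = mxsub (fun a => t (rshift i a)) (fun a => s (rshift i a)) M.
  by apply/matrixP => a b; rewrite !mxE.
(* Only the first block column of the inverse is kept. Determinants of these block triangular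
   matrices relate the upper left block of [N] to the lower right block of [M']. *)
have : M' *m block_mx (ulsubmx N) 0 (dlsubmx N) 1%:M =
    block_mx 1%:M (ursubmx M') 0 (drsubmx M').
  rewrite -{1}[M']submxK mulmx_block !mulmx0 !mulmx1 !add0r.
  have := MN; rewrite -{1}[M']submxK -{1}[N]submxK mulmx_block scalar_mx_block.
  by case/eq_block_mx => -> _ -> _.
move/(congr1 determinant); rewrite det_mulmx det_lblock det_ublock !det1 mulr1 mul1r.
rewrite detM' ulN drM -mulrA => <-.
have e (u : bool) : (-1) ^+ u * (-1) ^+ u = 1 :> K by rewrite -expr2 sqrr_sign.
by rewrite !mulrA [_ * _ * (-1) ^+ s]mulrAC e mul1r e mul1r.
Qed.

(** * Minor coordinates *)


Section MinorCoordinates.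
Variables (K : fieldType) (n : nat).
Implicit Types (D : coord_choice n) (E : set 'M[K]_n) (M : 'M[K]_n).

Lemma minor_idx_inhab i : (i <= n)%N -> minor_idx n i.
Proof.
move=> le_in; exists [ffun a => widen_ord le_in a].
by apply/forallP => a; apply/forallP => b; rewrite !ffunE /= implybb.
Qed.

Definition coord_minor D i (t : minor_coord D i) M : K := minor (val t).1 (val t).2 M.

Lemma coord_minorZ D i (t : minor_coord D i) c M :
  coord_minor t (c *: M) = c ^+ i * coord_minor t M.
Proof.
by rewrite /coord_minor /minor -detZ; congr (\det _); apply/matrixP => p q; rewrite !mxE.
Qed.

Lemma coord_minor1 D (t : minor_coord D 1) :
  exists k l, forall M, coord_minor t M = M k l.
Proof.
exists (val (val t).1 ord0), (val (val t).2 ord0) => M.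
by rewrite /coord_minor /minor det_mx11 mxE.
Qed.

(** [sym_minors] keeps one of each pair of transposed minors; on symmetric matrices nothing is lost.
    This is all that the transfer asks of a coordinate choice. *)
Definition covers D E := forall i (I J : minor_idx n i),
  exists t : minor_coord D i, forall M, E M -> minor I J M = coord_minor t M.

Lemma covers_all E : covers (@all_minors n) E.
Proof. by move=> i I J; exists (exist _ (I, J) isT). Qed.

Lemma covers_sym E : (forall M, E M -> M^T = M) -> covers (@sym_minors n) E.
Proof.
move=> symE i I J; have [IJ|/ltnW JI] := leqP (enum_rank I) (enum_rank J).
  by exists (exist _ (I, J) IJ).
exists (exist _ (J, I) JI) => M /symE MT.
by rewrite /minor -det_tr trmx_mxsub MT.
Qed.

Definition lincoord D E i (f : 'M[K]_n -> K) := exists a : minor_coord D i -> K,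
  forall M, E M -> f M = \sum_t a t * coord_minor t M.

Lemma lincoord_sum D E i (I : finType) (f : I -> 'M[K]_n -> K) (c : I -> K) :
  (forall p, lincoord D E i (f p)) ->
  lincoord D E i (fun M => \sum_p c p * f p M).
Proof.
move=> /boolp.choice[a aE]; exists (fun t => \sum_p c p * a p t) => M EM.
under [RHS]eq_bigr => t _ do rewrite mulr_suml.
rewrite exchange_big; apply: eq_bigr => p _.
by rewrite (aE _ _ EM) mulr_sumr; apply: eq_bigr => t _; rewrite mulrA.
Qed.

Lemma lincoord_ext D E i f g :
  (forall M, E M -> f M = g M) -> lincoord D E i f -> lincoord D E i g.
Proof. by move=> e [a aE]; exists a => M EM; rewrite -e // aE. Qed.

Lemma lincoordZ D E i c f : lincoord D E i f -> lincoord D E i (fun M => c * f M).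
Proof.
move=> [a aE]; exists (fun t => c * a t) => M EM.
by rewrite aE // mulr_sumr; apply: eq_bigr => t _; rewrite mulrA.
Qed.

Lemma lincoord_mxsub D E i (f g : 'I_i -> 'I_n) : covers D E ->
  lincoord D E i (fun M => \det (mxsub f g M)).
Proof.
move=> cD; have [a aE] := @det_mxsubE K n i f g.
suff : lincoord D E i (fun M => \sum_p a p * minor p.1 p.2 M).
  by apply: lincoord_ext => M _; rewrite aE.
apply: lincoord_sum => p; have [t tE] := cD i p.1 p.2.
exists (fun t' => (t' == t)%:R) => M EM.
rewrite (bigD1 t) //= eqxx mul1r big1 ?addr0 ?tE // => t' /negPf ->.
by rewrite mul0r.
Qed.

Lemma lincoord_mxsub_mulr D E i (f g : 'I_i -> 'I_n) A : covers D E ->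
  lincoord D E i (fun M => \det (mxsub f g (M *m A))).
Proof.
move=> cD; pose c (h : {ffun 'I_i -> 'I_n}) := \prod_a A (h a) (g a).
apply: (@lincoord_ext _ _ _ (fun M => \sum_h c h * \det (mxsub f h M))).
  by move=> M _; rewrite det_mxsub_mulr.
by apply: lincoord_sum => h; apply: lincoord_mxsub.
Qed.

Lemma lincoord_entry D E (i j : 'I_n) : covers D E ->
  lincoord D E 1 (fun M => M i j).
Proof.
move=> cD; apply: lincoord_ext (lincoord_mxsub (fun=> i) (fun=> j) cD) => M _.
by rewrite det_mx11 mxE.
Qed.

(** [factor] with the maximal rank made a parameter, so that spaces of equal maximal rank share one
    index type. *)
Definition factor_below r := {j : 'I_n.-1 | (j < r)%N}.

Definition factor_minors D r (j : factor_below r) := minor_coord D (val j).+1.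

Definition minor_map D r M : mvec K (@factor_minors D r) :=
  fun j => [ffun t => coord_minor t M].

Arguments minor_map D r M : clear implicits.

Definition rank_locus r (L : {vspace 'M[K]_n}) : set 'M[K]_n :=
  [set M | [/\ M \in L, M != 0 & (minn r n.-1 <= \rank M)%N]]%classic.

Lemma char_numE D (L : {vspace 'M[K]_n}) b : char_num D L b =
  if [forall j : 'I_n.-1, (max_rank L <= j)%N ==> (b j == 0%N)]
  then intersection_number (fun j : factor_below (max_rank L) => b (val j))
         (zclosure (minor_map D (max_rank L) @` rank_locus (max_rank L) L))
  else 0%N.
Proof. by []. Qed.

Lemma factor_minors_inhab D E r (j : factor_below r) :
  covers D E -> factor_minors D j.
Proof.
move=> cD; have I : minor_idx n (val j).+1.
  apply: minor_idx_inhab; case: j => -[j lj] /= _.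
  exact: leq_trans lj (leq_pred n).
by have [t _] := cid (cD _ I I).
Qed.

Lemma factor_lt r (j : factor_below r) : ((val j).+1 <= minn r n.-1)%N.
Proof. by case: j => -[j lj] /= jr; rewrite leq_min jr. Qed.

Lemma minor_map_point D E r M : covers D E -> E M ->
  (minn r n.-1 <= \rank M)%N -> mproj_point (minor_map D r M).
Proof.
move=> cD EM rM j; have [I [J]] := rank_minor_neq0 (leq_trans (factor_lt j) rM).
have [t tE] := cD _ I J; rewrite tE //; apply: contra => /eqP/ffunP/(_ t).
by rewrite !ffunE => ->.
Qed.

End MinorCoordinates.

Arguments minor_map {K n} D r M.

(** One scalar [c M] serves all factors simultaneously, while [sg] says from which factor the
    coordinates come. *)
Definition scaled_pullback (K : fieldType) n r (sg : factor_below n r -> factor_below n r)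
    (D D' : coord_choice n) (E : set 'M[K]_n) u (c : 'M[K]_n -> K) :=
  forall j (t : factor_minors D' j),
    lincoord D E (val (sg j)).+1 (fun M => c M * coord_minor t (u M)).

Lemma minor_map_pullback (K : fieldType) n r sg (D D' : coord_choice n)
    (E : set 'M[K]_n) u c :
  @scaled_pullback K n r sg D D' E u c ->
  forall j t, exists a : factor_minors D (sg j) -> K, forall M, E M ->
    c M * minor_map D' r (u M) j t = \sum_s a s * minor_map D r M (sg j) s.
Proof.
move=> h j t; have [a aE] := h j t; exists a => M /aE; rewrite ffunE => ->.
by apply: eq_bigr => s _; rewrite ffunE.
Qed.

Lemma intersection_number_minors (K : numFieldType) n r (D D' : coord_choice n)
    (E E' : set 'M[K]_n) u v c c' (sg : factor_below n r -> factor_below n r) b :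
  involutive sg -> covers D E -> covers D' E' ->
  (forall M, E M -> minn r n.-1 <= \rank M)%N ->
  (forall M, E' M -> minn r n.-1 <= \rank M)%N ->
  (forall M, E M -> [/\ E' (u M), v (u M) = M & c M * c' (u M) = 1]) ->
  (forall M, E' M -> [/\ E (v M), u (v M) = M & c' M * c (v M) = 1]) ->
  scaled_pullback sg D D' E u c -> scaled_pullback sg D' D E' v c' ->
  intersection_number b (zclosure (minor_map D r @` E)) =
  intersection_number (b \o sg) (zclosure (minor_map D' r @` E')).
Proof.
move=> sgK cD cD' rE rE' uE vE' pu pv.
apply: (intersection_number_param sgK _ _ _ _ _ uE vE'
  (minor_map_pullback pu) (minor_map_pullback pv)).
- by move=> j; apply: factor_minors_inhab cD.
- by move=> j; apply: factor_minors_inhab cD'.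
- by move=> M EM; apply: (minor_map_point cD EM (rE M EM)).
- by move=> M EM; apply: (minor_map_point cD' EM (rE' M EM)).
Qed.

Lemma eq_max_rank (K : fieldType) n (L L' : {vspace 'M[K]_n}) :
  (forall r, (exists2 M, M \in L & \rank M = r) <->
             (exists2 M, M \in L' & \rank M = r)) ->
  max_rank L = max_rank L'.
Proof. by move=> h; apply: eq_bigl => r; apply/asboolP/asboolP => /h. Qed.

Lemma char_num_mulr (K : numFieldType) n (L L' : {vspace 'M[K]_n}) (G : 'M[K]_n)
    (b : 'I_n.-1 -> nat) :
  G \in unitmx -> (forall M, M \in L -> M^T = M) ->
  (forall M, M \in L -> M *m invmx G \in L') ->
  (forall M, M \in L' -> M *m G \in L) ->
  char_num (@sym_minors n) L b = char_num (@all_minors n) L' b.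
Proof.
move=> uG symL LL' L'L; rewrite !char_numE.
have rkM H (M : 'M[K]_n) : H \in unitmx -> \rank (M *m H) = \rank M.
  by move=> uH; rewrite mxrankMfree // row_free_unit.
have uG' : invmx G \in unitmx by rewrite unitmx_inv.
have -> : max_rank L = max_rank L'.
  apply: eq_max_rank => r; split=> -[M ML <-].
    by exists (M *m invmx G); rewrite ?LL' ?rkM.
  by exists (M *m G); rewrite ?L'L ?rkM.
case: ifP => _; last by [].
set r := max_rank L'.
have neq0 H (M : 'M[K]_n) : H \in unitmx -> M != 0 -> M *m H != 0.
  by move=> uH; rewrite -!mxrank_eq0 rkM.
apply: (@intersection_number_minors _ _ _ _ _ _ _ (mulmx^~ (invmx G)) (mulmx^~ G)
  (fun=> 1) (fun=> 1) id) => //.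
- by apply: covers_sym => M [/symL].
- exact: covers_all.
- by move=> M [].
- by move=> M [].
- move=> M [ML M0 rM]; split; rewrite ?mulr1 ?mulmxKV //.
  by split; rewrite ?LL' ?neq0 ?rkM.
- move=> M [ML M0 rM]; split; rewrite ?mulr1 ?mulmxK //.
  by split; rewrite ?L'L ?neq0 ?rkM.
- move=> j t; apply/lincoordZ/lincoord_mxsub_mulr.
  by apply: covers_sym => M [/symL].
- by move=> j t; apply/lincoordZ/lincoord_mxsub_mulr/covers_all.
Qed.

(** * Inversion *)


Lemma mvec_eval_curve (K : fieldType) (F : finType) (T : F -> finType)
    (P : {mpoly K[#|{: mvar T}|]}) (x : K -> mvec K T) :
  (forall j c, exists q : {poly K}, forall t, q.[t] = x t j c) ->
  exists q : {poly K}, forall t, q.[t] = mvec_eval P (x t).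
Proof.
move=> h; have /boolp.choice[q qE] (k : 'I_#|{: mvar T}|) :=
  h (tag (enum_val k)) (tagged (enum_val k)).
exists (\sum_(m <- msupp P) P@_m *: \prod_k q k ^+ m k) => t.
rewrite /mvec_eval mevalE horner_sum; apply: eq_bigr => m _.
rewrite hornerZ horner_prod; congr (_ * _); apply: eq_bigr => k _.
by rewrite horner_exp qE.
Qed.

Section Lines.
Variables (K : numFieldType) (n : nat).
Implicit Types (M N : 'M[K]_n).

Lemma det_mxsub_line i (f g : 'I_i -> 'I_n) M N :
  exists q : {poly K}, forall t, q.[t] = \det (mxsub f g (M + t *: N)).
Proof.
exists (\det (mxsub f g (map_mx polyC M + 'X *: map_mx polyC N))) => t.
rewrite -[LHS]/(horner_eval t _) -det_map_mx; congr (\det _).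
apply/matrixP => a b; rewrite !mxE /= /horner_eval.
by rewrite hornerD hornerC mulrC hornerMX hornerC mulrC.
Qed.

Lemma coord_minor_line (D : coord_choice n) i (c : minor_coord D i) M N :
  exists q : {poly K}, forall t, q.[t] = coord_minor c (M + t *: N).
Proof. exact: det_mxsub_line. Qed.

Lemma minor_map_line D r (P : {mpoly K[#|{: mvar (@factor_minors n D r)}|]}) M N :
  exists q : {poly K}, forall t, q.[t] = mvec_eval P (minor_map D r (M + t *: N)).
Proof.
apply: mvec_eval_curve => j c.
have [q qE] := coord_minor_line c M N.
by exists q => t; rewrite qE ffunE.
Qed.

(** The line from a matrix of [E] to the invertible [N] is singular at finitely many parameters
    only, so a polynomial that vanishes at the invertible matrices vanishes on the whole line. *)
Lemma zclosure_units D r (L : {vspace 'M[K]_n}) (E : set 'M[K]_n) N :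
  N \in L -> N \in unitmx -> (forall M, E M -> M \in L) ->
  (forall M, M \in L -> M \in unitmx -> E M) ->
  zclosure (minor_map D r @` E) =
  zclosure (minor_map D r @` [set M | M \in L /\ M \in unitmx]%classic).
Proof.
move=> NL uN EL LE; apply/seteqP; split=> x [px hx]; split=> // P mP SP.
  apply: hx => // _ [M EM <-].
  have [q qE] := minor_map_line P M (N - M).
  have [d dE] := det_mxsub_line id id M (N - M).
  have d0 : d != 0.
    apply: contraTneq uN => d0; have := dE 1.
    by rewrite d0 horner0 mxsub_id scale1r addrC subrK unitmxE unitfE => <-; rewrite eqxx.
  (* Where the determinant [d] is nonzero, [q] vanishes by assumption; elsewhere [d] does. *)
  have : q * d = 0.
    apply: horner_eq0 => t; rewrite hornerM qE dE mxsub_id.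
    have [u|] := boolP (M + t *: (N - M) \in unitmx); last first.
      by rewrite unitmxE unitfE negbK => /eqP ->; rewrite mulr0.
    rewrite SP ?mul0r //; exists (M + t *: (N - M)) => //; split=> //.
    have ML := EL _ EM; by rewrite memvD ?memvZ ?memvB.
  move/eqP; rewrite mulf_eq0 (negPf d0) orbF => /eqP q0.
  by have := qE 0; rewrite q0 horner0 scale0r addr0.
apply: hx => // _ [M [ML uM] <-]; apply: SP; exists M => //; exact: LE.
Qed.

End Lines.

Lemma max_rank_unit (K : fieldType) n (L : {vspace 'M[K]_n}) M :
  M \in L -> M \in unitmx -> max_rank L = n.
Proof.
move=> ML uM; apply/eqP; rewrite eqn_leq; apply/andP; split.
  by apply/bigmax_leqP => r _; rewrite -ltnS.
apply: (@leq_bigmax_cond _ _ (fun r : 'I_n.+1 => nat_of_ord r) ord_max).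
by apply/asboolP; exists M => //; rewrite mxrank_unit.
Qed.

Lemma coord_minor_invmx (K : fieldType) n i m (t : minor_coord (@all_minors n) i)
    (E : set 'M[K]_n) :
  (i + m)%N = n -> (forall M, E M -> M \in unitmx) ->
  lincoord (@all_minors n) E m (fun M => \det M * coord_minor t (invmx M)).
Proof.
move=> im uE; have [f' [g' [c cE]]] := @det_mxsub_invmx K n i m _ _ im
  (@minor_idx_inj _ _ (val t).1) (@minor_idx_inj _ _ (val t).2).
apply: (@lincoord_ext _ _ _ _ _ (fun M => c * \det (mxsub g' f' M))).
  by move=> M /uE uM; rewrite -cE.
exact/lincoordZ/lincoord_mxsub/covers_all.
Qed.

Lemma char_num_invmx (K : numFieldType) n (L : {vspace 'M[K]_n}) b :
  (0 < n)%N -> 1%:M \in L ->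
  (forall M, M \in L -> M \in unitmx -> invmx M \in L) ->
  char_num (@all_minors n) L b = char_num (@all_minors n) L (b \o @rev_ord n.-1).
Proof.
move=> n0 L1 LV; rewrite !char_numE (max_rank_unit L1 (unitmx1 _ _)).
have guard (b' : 'I_n.-1 -> nat) :
    [forall j : 'I_n.-1, (n <= j)%N ==> (b' j == 0%N)].
  apply/forallP => j; rewrite leqNgt (leq_trans (ltn_ord j)) //; exact: leq_pred.
rewrite !guard.
have unit0 (M : 'M[K]_n) : M \in unitmx -> M != 0.
  by move=> uM; rewrite -mxrank_eq0 mxrank_unit // -lt0n.
(* The rank locus also contains matrices of corank 1, where inversion is undefined; the invertible
   ones have the same closure and are stable under it. *)
have -> := @zclosure_units K n (@all_minors n) n L (rank_locus n L) 1%:M L1 (unitmx1 _ _).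
- have rP (j : factor_below n n) : (rev_ord (val j) < n)%N.
    exact: leq_trans (ltn_ord (rev_ord (val j))) (leq_pred n).
  pose sg (j : factor_below n n) : factor_below n n := exist _ (rev_ord (val j)) (rP j).
  have rk (M : 'M[K]_n) : M \in unitmx -> (minn n n.-1 <= \rank M)%N.
    by move=> uM; rewrite mxrank_unit // geq_minl.
  have inv (M : 'M[K]_n) : M \in L /\ M \in unitmx ->
      [/\ [set M | M \in L /\ M \in unitmx]%classic (invmx M),
      invmx (invmx M) = M & \det M * \det (invmx M) = 1].
    move=> [ML uM]; split; first by rewrite /= LV // unitmx_inv.
      exact: invmxK.
    by rewrite det_inv divrr // -unitmxE.
  have pb : scaled_pullback sg (@all_minors n) (@all_minors n)
      [set M | M \in L /\ M \in unitmx]%classic invmx determinant.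
    move=> j t; apply: (coord_minor_invmx t) => [|M []//].
    (* Index [j] means minors of size [j.+1], whose complements have size [n - j.+1], the size
       attached to [rev_ord j]. *)
    rewrite /=; case: (val j) => i /= ilt; rewrite addnS subnKC //; exact: prednK.
  apply: (intersection_number_minors _ _ _ _ _ _ inv inv pb pb).
  - by move=> j; apply: val_inj; rewrite /= rev_ordK.
  - exact: covers_all.
  - exact: covers_all.
  - by move=> M [_]; exact: rk.
  - by move=> M [_]; exact: rk.
- by move=> M [].
- move=> M ML uM; split=> //; first exact: unit0.
  by rewrite mxrank_unit // geq_minl.
Qed.

(** * Generic points of linear sections *)


Lemma num_points_leq (K : fieldType) (F : finType) (T : F -> finType)
    (X : set (mvec K T)) c c' : num_points X c -> num_points X c' -> (c <= c')%N.
Proof.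
move=> [p [Xp injp _]] [p' [_ _ sur]].
have /boolp.choice[f fE] : forall k, exists l, mproj_eq (p' l) (p k).
  by move=> k; apply: sur.
rewrite -[c]card_ord -[c']card_ord; apply: (@leq_card _ _ f) => k l fkl.
apply: injp; apply: mproj_eq_trans (fE l).
by rewrite -fkl; apply: mproj_eq_sym.
Qed.

(** Two generic counts agree because their two nonempty open sets share a point. *)
Lemma intersection_number_eq (K : numFieldType) (F : finType) (T : F -> finType)
    (b : F -> nat) (X : set (mvec K T)) c :
  (forall j, T j) -> general_num_points b X c -> intersection_number b X = c.
Proof.
move=> t0 gc; apply: xget_unique => // c' [G' G'0 G'c]; case: gc => G G0 Gc.
have [|h ph] := mproj_point_eval_neq0 _ (mulf_neq0 G0 G'0).
  by move=> s; apply: t0.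
rewrite /mvec_eval mevalM mulf_eq0 negb_or => /andP[/(Gc _ ph) nc /(G'c _ ph) nc'].
by apply/eqP; rewrite eqn_leq (num_points_leq nc' nc) (num_points_leq nc nc').
Qed.

(** * Cramer's rule for d linear equations in d + 1 unknowns *)

Section Cramer.
Variables (K : fieldType) (d : nat) (H : 'M[K]_(d, d.+1)).

Definition cross_product : 'cV[K]_d.+1 :=
  \col_l ((-1) ^+ l * \det (col' l H)).

Lemma cofactor_col_mx (w : 'rV[K]_d.+1) l :
  cofactor (col_mx w H : 'M_(1 + d)) 0 l = cross_product l 0.
Proof.
rewrite mxE /cofactor add0n; congr (_ * \det _).
apply/matrixP => a b; rewrite !mxE; case: splitP => c /=.
  by rewrite ord1 => /eqP; rewrite /bump.
by rewrite /bump /= => -[/val_inj ->].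
Qed.

(** The first column of the adjugate does not see the first row, so [w] may be chosen freely. *)
Lemma adj_col_mx (w : 'rV[K]_d.+1) l :
  (\adj (col_mx w H : 'M_(1 + d))) l 0 = cross_product l 0.
Proof. by rewrite mxE cofactor_col_mx. Qed.

Lemma mulmx_cross_product : H *m cross_product = 0.
Proof.
have := mul_mx_adj (col_mx 0 H : 'M[K]_(1 + d)).
have -> : \det (col_mx 0 H : 'M[K]_(1 + d)) = 0.
  rewrite (expand_det_row _ 0) big1 // => l _.
  by rewrite mxE; case: splitP => // c; rewrite ?mxE ?mul0r // => /eqP.
move=> e; apply/colP => k; move/matrixP/(_ (rshift 1 k) 0): e.
rewrite mxE [RHS]mxE mul0rn => e; rewrite mxE [RHS]mxE -[RHS]e.
by apply: eq_bigr => l _; rewrite adj_col_mx col_mxEd.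
Qed.

(** Completing [H] by the unit row at [l] sends [y] to [y l 0] times the first unit vector; the
    adjugate inverts this up to the determinant. No rank assumption enters. *)
Lemma cross_productP (y : 'cV[K]_d.+1) l :
  H *m y = 0 -> cross_product l 0 *: y = y l 0 *: cross_product.
Proof.
move=> Hy; pose w : 'rV[K]_d.+1 := delta_mx 0 l.
pose N : 'M_(1 + d) := col_mx w H.
have detN : \det N = cross_product l 0.
  rewrite (expand_det_row _ 0) (bigD1 l) //= big1 ?addr0 => [|k kl].
    rewrite cofactor_col_mx (_ : N 0 l = 1) ?mul1r //.
    by rewrite mxE; case: splitP => // c _; rewrite mxE ord1 !eqxx.
  rewrite (_ : N 0 k = 0) ?mul0r //.
  by rewrite mxE; case: splitP => // c _; rewrite mxE (negPf kl) andbF.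
have Ny : N *m y = y l 0 *: delta_mx 0 0.
  rewrite mul_col_mx Hy -rowE; apply/colP => k; rewrite !mxE.
  case: splitP => c e; rewrite !mxE.
    by rewrite ord1 in e; rewrite (_ : k = 0) ?mulr1 //; apply: val_inj.
  by case: eqP => [k0|]; rewrite ?mulr0 //; rewrite k0 in e.
have : \adj N *m (N *m y) = cross_product l 0 *: y.
  by rewrite mulmxA mul_adj_mx detN mul_scalar_mx.
move=> <-; rewrite Ny -scalemxAr; congr (_ *: _).
by rewrite -colE; apply/colP => k; rewrite mxE adj_col_mx.
Qed.

End Cramer.

Lemma max_rank_attained (K : fieldType) n (L : {vspace 'M[K]_n}) :
  exists2 M, M \in L & \rank M = max_rank L.
Proof.
pose p := [pred r : 'I_n.+1 | `[< exists2 M, M \in L & \rank M = r >]].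
have [|r] := @eq_bigmax_cond _ p (fun r : 'I_n.+1 => nat_of_ord r).
  apply/card_gt0P; exists ord0; apply/asboolP; exists 0; rewrite ?mem0v //.
  by rewrite mxrank0.
by move=> /asboolP[M ML rM] e; exists M => //; rewrite rM -e.
Qed.

Lemma rank_le_max_rank (K : fieldType) n (L : {vspace 'M[K]_n}) M :
  M \in L -> (\rank M <= max_rank L)%N.
Proof.
move=> ML; have lt : (\rank M < n.+1)%N by rewrite ltnS rank_leq_row.
apply: (@leq_bigmax_cond _ _ (fun r : 'I_n.+1 => nat_of_ord r) (Ordinal lt)).
by apply/asboolP; exists M.
Qed.

Lemma linear_mxE (K : fieldType) m n (phi : {linear 'M[K]_(m, n) -> K^o}) M :
  phi M = \sum_i \sum_j M i j * phi (delta_mx i j).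
Proof.
rewrite {1}[M]matrix_sum_delta linear_sum; apply: eq_bigr => i _.
by rewrite linear_sum; apply: eq_bigr => j _; rewrite linearZ.
Qed.

(** * The first characteristic number *)


Lemma basis_with_head (K : fieldType) (V : vectType K) (U : {vspace V}) x d :
  x \in U -> x != 0 -> \dim U = d.+1 ->
  exists2 B : d.+1.-tuple V, basis_of U B & B`_0 = x.
Proof.
move=> xU x0 dU; pose W := (U :\: <[x]>)%VS; pose s := x :: vbasis W.
have bs : basis_of U s.
  have -> : U = (<[x]> + W)%VS.
    by rewrite addvC addv_diff; apply/esym/addv_idPl; rewrite -memvE.
  have dW : directv (<[x]> + W) by apply/directv_addP; rewrite capvC capv_diff.
  have := cat_basis dW (seq1_basis x0) (vbasisP W); exact.
have sz : size s == d.+1 by rewrite -dU (vector.size_basis (X := in_tuple s) bs).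
by exists (Tuple sz).
Qed.

Section FirstTerm.
Variables (K : numFieldType) (n d : nat) (L : {vspace 'M[K]_n}).
Hypotheses (symL : forall M, M \in L -> M^T = M) (dimL : \dim L = d.+1).

Local Notation r := (max_rank L).
Local Notation S := (rank_locus r L).
Local Notation Dsym := (@sym_minors n).
Local Notation T := (@factor_minors n Dsym r).

Let covL : covers Dsym [set M | M \in L]%classic.
Proof. exact: covers_sym. Qed.

Let covS : covers Dsym S.
Proof. by apply: covers_sym => M [/symL]. Qed.

Lemma max_rank_gt0 : (0 < r)%N.
Proof.
have [x xL x0] : exists2 x, x \in L & x != 0.
  by exists (vpick L); rewrite ?memv_pick // vpick0 -dimv_eq0 dimL.
by apply: leq_trans (rank_le_max_rank xL); rewrite lt0n mxrank_eq0.
Qed.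

(** The empty product of projective spaces is one point. *)
Lemma general_num_points_no_factor (b : factor_below n r -> nat) :
  (n <= 1)%N -> general_num_points b (zclosure (minor_map Dsym r @` S)) 1.
Proof.
move=> n1; have noF (j : factor_below n r) : False.
  by case: j => -[j jn] _; lia.
exists 1; first exact: oner_neq0.
move=> h _ _; have [M ML rM] := max_rank_attained L.
exists (fun=> minor_map Dsym r M); split=> [_|k l _|x _].
- split=> [|[j]]; last by case: (noF j).
  apply: zclosure_incl => [|j]; last by case: (noF j).
  exists M => //; split=> //; last by rewrite rM geq_minl.
  by rewrite -mxrank_eq0 rM -lt0n max_rank_gt0.
- by rewrite !ord1.
- by exists 0 => j; case: (noF j).
Qed.

Hypothesis n1 : (0 < n.-1)%N.

Let j0 : factor_below n r := exist _ (Ordinal n1) max_rank_gt0.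

Let b (j : factor_below n r) : nat := if val (val j) == 0%N then d else 0%N.

Lemma entry_coef : exists a : 'I_n -> 'I_n -> forall j, T j -> K,
  forall M, M \in L -> forall k l,
    M k l = \sum_(t : T j0) a k l j0 t * minor_map Dsym r M j0 t.
Proof.
have h k l : {a : forall j, T j -> K | forall M, M \in L ->
    M k l = \sum_(t : T j0) a j0 t * minor_map Dsym r M j0 t}.
  apply: cid; have [a aE] := lincoord_entry k l covL.
  have [a' a'E] := @extend_family K _ T j0 a.
  by exists a' => M /aE ->; apply: eq_bigr => t _; rewrite a'E ffunE.
by exists (fun k l => sval (h k l)) => M ML k l; exact: (svalP (h k l)).
Qed.

Lemma general_num_points_first :
  general_num_points b (zclosure (minor_map Dsym r @` S)) 1.
Proof.
have [Mx MxL rMx] := max_rank_attained L.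
have Mx0 : Mx != 0 by rewrite -mxrank_eq0 rMx -lt0n max_rank_gt0.
have [B bB B0] := basis_with_head MxL Mx0 dimL.
have [a aE] := entry_coef.
set r0 := minn r n.-1.
have r0Mx : (r0 <= \rank Mx)%N by rewrite rMx geq_minl.
have r0_gt0 : (0 < r0)%N by rewrite leq_min max_rank_gt0.
have [I [J IJ]] := rank_minor_neq0 r0Mx.
(* The matrix encoded in the first factor of any point, limit points included. *)
pose Y (x : mvec K T) : 'M[K]_n := \matrix_(k, l) \sum_(t : T j0) a k l j0 t * x j0 t.
have YE M : M \in L -> Y (minor_map Dsym r M) = M.
  by move=> ML; apply/matrixP => k l; rewrite mxE -aE.
have Yhom k l : mhomfun (fun j => nat_of_bool (j0 == j)) (fun x => Y x k l).
  apply: (@mhomfun_ext _ _ _ (fun j => nat_of_bool (j0 == j)) _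
    (fun x => \sum_(t : T j0) a k l j0 t * x j0 t)) => //.
    by move=> x; rewrite mxE.
  by apply: mhomfun_sum => t _; apply/mhomfunZ/mhomfun_coord.
pose sk (k : 'I_d) : {j : factor_below n r & 'I_(b j)} :=
  existT (fun j => 'I_(b j)) j0 k.
have skP s : exists k, s = sk k.
  case: s => j k; have jj0 : j = j0.
    apply/val_inj/val_inj => /=; move: k; rewrite /b.
    by case: eqP => [->|_ []].
  by subst j; exists k.
(* The values of the [d] forms on the basis [B] of [L]. Their common zero [M0 h] is polynomial in
   [h], and its minor [(I, J)] will serve as [G]: where that is nonzero, [M0 h] lies in the rank
   locus. *)
pose H (h : hyps K T b) : 'M[K]_(d, d.+1) :=
  \matrix_(k, l) \sum_(t : T j0) h (sk k) t * minor_map Dsym r B`_l j0 t.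
pose v h := cross_product (H h).
pose M0 h : 'M[K]_n := \sum_(l < d.+1) v h l 0 *: B`_l.
have BL l : B`_(l : 'I_d.+1) \in L.
  by apply: (basis_mem bB); rewrite mem_nth // size_tuple.
have M0L h : M0 h \in L by apply: memv_suml => l _; rewrite memvZ.
have Gpoly : polyfun (fun h => minor I J (M0 h)).
  have vpoly l : polyfun (fun h => v h l 0).
    apply: (@polyfun_ext _ _ _ (fun h => (-1) ^+ l * \det (\matrix_(p, q)
      \sum_(t : T j0) h (sk p) t * minor_map Dsym r B`_(lift l q) j0 t))).
      move=> h; rewrite mxE; congr (_ * \det _).
      by apply/matrixP => p q; rewrite !mxE.
    apply: polyfun_mul; first exact: polyfun_const.
    apply: polyfun_det => p q; apply: polyfun_sum => t.
    by apply: polyfun_mul; [exact: polyfun_coord | exact: polyfun_const].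
  apply: (@polyfun_ext _ _ _ (fun h => \det (\matrix_(p, q)
    \sum_(l < d.+1) v h l 0 * B`_l (val I p) (val J q)))).
    move=> h; congr (\det _); apply/matrixP => p q.
    by rewrite [LHS]mxE [RHS]mxE summxE; apply: eq_bigr => l _; rewrite [RHS]mxE.
  apply: polyfun_det => p q; apply: polyfun_sum => l.
  by apply: polyfun_mul; [exact: vpoly | exact: polyfun_const].
have [G GE] := Gpoly; exists G.
  pose phi k (M : 'M[K]_n) : K^o := coord B (inord k.+1) M.
  pose h : hyps K T b := fun s => [ffun t : T (tag s) => \sum_p \sum_q
    a p q (tag s) t * phi (tagged s) (delta_mx p q)].
  have Hh : H h = row_mx (0 : 'cV_d) 1%:M.
    apply/matrixP => k l; rewrite mxE.
    have -> : \sum_(t : T j0) h (sk k) t * minor_map Dsym r B`_l j0 t = phi k B`_l.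
      under eq_bigr => t _ do rewrite ffunE mulr_suml.
      rewrite exchange_big /= /phi linear_mxE; apply: eq_bigr => p _.
      under eq_bigr => t _ do rewrite mulr_suml.
      rewrite exchange_big /=; apply: eq_bigr => q _.
      rewrite (aE _ (BL l)) mulr_suml; apply: eq_bigr => t _.
      by rewrite mulrAC.
    rewrite /phi coord_free ?(basis_free bB) // mxE.
    have e : nat_of_ord (inord k.+1 : 'I_d.+1) = k.+1 by rewrite inordK // ltnS.
    by case: splitP => c lc; rewrite -val_eqE /= e lc ?ord1 ?mxE // add1n eqSS eq_sym.
  have v0 : v h 0 0 = 1.
    rewrite /v mxE Hh mul1r (_ : col' 0 _ = 1%:M) ?det1 //.
    apply/matrixP => p q; rewrite !mxE; case: splitP => c /=.
      by rewrite ord1.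
    by rewrite /bump /= => -[/val_inj ->]; rewrite mxE.
  have vS k : v h (lift 0 k) 0 = 0.
    have /matrixP/(_ k 0) := mulmx_cross_product (H h).
    rewrite -/(v h) mxE [RHS]mxE big_ord_recl (bigD1 k) //= big1 ?addr0.
      rewrite Hh [_ k 0]mxE; case: splitP => // c _.
      rewrite mxE mul0r add0r [_ k (lift _ _)]mxE; case: splitP => c' /=.
        by rewrite ord1.
      by rewrite /bump /= => -[/val_inj ->]; rewrite mxE eqxx mul1r.
    move=> l lk; rewrite Hh mxE; case: splitP => c /=.
      by rewrite ord1.
    rewrite /bump /= => -[/val_inj <-].
    by rewrite mxE eq_sym (negPf lk) mul0r.
  have : minor I J (M0 h) != 0.
    rewrite /M0 big_ord_recl v0 scale1r B0 big1 ?addr0 // => l _.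
    by rewrite vS scale0r.
  by rewrite -GE; exact: mvec_eval_neq0_poly.
move=> h ph; rewrite GE => Mh0.
have M0rk : (r0 <= \rank (M0 h))%N := minor_neq0_rank Mh0.
have M0S : S (M0 h).
  by split=> //; rewrite -mxrank_eq0 -lt0n; apply: leq_trans M0rk.
have hM (y : 'I_d * 'cV[K]_d.+1) :
    \sum_(t : T j0) h (sk y.1) t *
      minor_map Dsym r (\sum_(l < d.+1) y.2 l 0 *: B`_l) j0 t = (H h *m y.2) y.1 (0 : 'I_1).
  rewrite [RHS]mxE; under [RHS]eq_bigr => l _ do rewrite mxE mulr_suml.
  rewrite exchange_big /=; apply: eq_bigr => t _.
  have [p [q tE]] := coord_minor1 K t; rewrite ffunE tE summxE mulr_sumr.
  apply: eq_bigr => l _; rewrite mxE -mulrA; congr (_ * _).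
  by rewrite ffunE tE mulrC.
exists (fun=> minor_map Dsym r (M0 h)); split=> [_|k l _|x [Xx hx]].
- split.
    by apply: zclosure_incl; [exists (M0 h) | apply: minor_map_point covS M0S M0rk].
  move=> s; have [k ->] := skP s.
  by rewrite [LHS](hM (k, v h)) mulmx_cross_product mxE.
- by rewrite !ord1.
have Xlin f : (forall M, M \in L -> f (minor_map Dsym r M) = 0) ->
    (exists deg, mhomfun deg f) -> f x = 0.
  move=> f0 [deg fh]; apply: (zclosure_mhomfun fh _ Xx) => _ [M [ML _ _] <-].
  exact: f0.
have YL : Y x \in L.
  suff -> : Y x = projv L (Y x) by apply: memv_proj.
  (* Membership in [L] becomes linear equations through the projection onto [L]. *)
  apply/matrixP => p q; apply/eqP; rewrite -subr_eq0; apply/eqP.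
  pose f z := Y z p q - projv L (Y z) p q.
  apply: (Xlin f) => [M ML|]; first by rewrite /f YE // projv_id // subrr.
  exists (fun j => nat_of_bool (j0 == j)); apply: mhomfun_add => //.
  pose g z := \sum_k \sum_l (- (projv L (delta_mx k l)) p q) * Y z k l.
  apply: (@mhomfun_ext _ _ _ (fun j => nat_of_bool (j0 == j)) _ g) => [//|z|].
    rewrite /g [in RHS](matrix_sum_delta (Y z)) linear_sum summxE -sumrN.
    apply: eq_bigr => k _; rewrite linear_sum summxE -sumrN.
    by apply: eq_bigr => l _; rewrite linearZ [X in _ = - X]mxE mulNr mulrC.
  by apply: mhomfun_sum => k _; apply: mhomfun_sum => l _; apply: mhomfunZ.
have xj0 (t : T j0) : x j0 t = coord_minor t (Y x).
  have [p [q tE]] := coord_minor1 K t; rewrite tE; apply/eqP; rewrite -subr_eq0; apply/eqP.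
  apply: (Xlin (fun z => z j0 t - Y z p q)) => [M ML|].
    by rewrite YE // ffunE tE subrr.
  exists (fun j => nat_of_bool (j0 == j)); apply: mhomfun_add.
    exact: mhomfun_coord.
  have := mhomfunZ (-1) (Yhom p q).
  by apply: mhomfun_ext => // z; rewrite mulN1r.
pose y : 'cV[K]_d.+1 := \col_l coord B l (Y x).
have yE : Y x = \sum_(l < d.+1) y l 0 *: B`_l.
  rewrite {1}(coord_basis bB YL); apply: eq_bigr => l _.
  by rewrite [y l 0]mxE.
have Hy : H h *m y = 0.
  apply/colP => k; rewrite [RHS]mxE -[RHS](hx (sk k)) -[LHS](hM (k, y)) -yE.
  by apply: eq_bigr => t _; rewrite ffunE [in RHS]xj0.
have [l vl] : exists l, v h l 0 != 0.
  apply: contrapT => /forallNP vN; case: M0S => _ /eqP[]; rewrite /M0 big1 // => l _.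
  by have /negP/negPn/eqP -> := vN l; rewrite scale0r.
pose mu := y l 0 / v h l 0.
have YM : Y x = mu *: M0 h.
  rewrite yE /M0 scaler_sumr; apply: eq_bigr => k _; rewrite scalerA.
  congr (_ *: _); apply: (mulfI vl); rewrite mulrA [v h l 0 * mu]mulrC divfK //.
  have /matrixP/(_ k 0) := cross_productP l Hy.
  by rewrite [LHS]mxE [RHS]mxE.
have mu0 : mu != 0.
  apply: contraTneq isT => mu0; have := proj1 Xx j0; rewrite -[_ != _]negbK; case/negP.
  apply/negPn/eqP/ffunP => t; have [p [q tE]] := coord_minor1 K t.
  by rewrite xj0 tE YM mu0 scale0r !mxE ffunE.
(* The first factor of [x] is now known to be [M0 h] up to [mu]; each remaining factor is compared
   with it at a coordinate [t'] that does not vanish there. *)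
exists 0 => j.
have [Ij [Jj]] := rank_minor_neq0 (leq_trans (factor_lt j) M0rk).
have [t' t'E] := covS Ij Jj; rewrite t'E // => t'0.
have minorZ (t : T j) : coord_minor t (Y x) =
    mu ^+ (val j).+1 * coord_minor t (M0 h).
  by rewrite YM coord_minorZ.
(* On the graph, factor [j] is the vector of minors of [Y]. The cross-multiplied form of this is
   multihomogeneous and hence survives in the closure. *)
have cross (t : T j) : x j t * coord_minor t' (M0 h) =
    x j t' * coord_minor t (M0 h).
  apply: (mulfI (expf_neq0 (val j).+1 mu0)); rewrite mulrCA -minorZ [RHS]mulrCA -minorZ.
  apply/eqP; rewrite -subr_eq0; apply/eqP.
  rewrite mulrC [X in _ - X]mulrC.
  apply: (Xlin (fun z => coord_minor t' (Y z) * z j t -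
     coord_minor t (Y z) * z j t')) => [M ML|].
    by rewrite YE // !ffunE mulrC subrr.
  have minorh (t1 : T j) : mhomfun (fun j1 => (val j).+1 * (j0 == j1))%N
      (fun z => coord_minor t1 (Y z)).
    have := mhomfun_det (fun p q => Yhom (val (val t1).1 p) (val (val t1).2 q)).
    by apply: mhomfun_ext => // z; congr (\det _).
  exists (fun j1 => (val j).+1 * (j0 == j1) + (j == j1))%N.
  apply: mhomfun_add.
    exact: (mhomfun_mul (minorh t') (@mhomfun_coord K _ T j t)).
  have := mhomfunZ (-1) (mhomfun_mul (minorh t) (@mhomfun_coord K _ T j t')).
  by apply: mhomfun_ext => // z; rewrite mulN1r.
exists (x j t' / coord_minor t' (M0 h)).
  apply: mulf_neq0; last by rewrite invr_eq0.
  apply: contraTneq isT => xt'; have := proj1 Xx j; rewrite -[_ != _]negbK; case/negP.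
  apply/negPn/eqP/ffunP => t; rewrite [RHS]ffunE; apply: (mulIf t'0).
  by rewrite mul0r cross xt' mul0r.
apply/ffunP => t; rewrite [RHS]ffunE ffunE; apply: (mulIf t'0).
by rewrite cross [RHS]mulrAC mulfVK.
Qed.

End FirstTerm.

(** * Matrices attached to an algebra *)


Lemma char_num_first (K : numFieldType) n d (L : {vspace 'M[K]_n}) :
  (forall M, M \in L -> M^T = M) -> \dim L = d.+1 ->
  char_num (@sym_minors n) L (@seq_exponents n d 0) = 1%N.
Proof.
move=> symL dimL; rewrite char_numE.
have r0 := max_rank_gt0 dimL.
have -> : [forall j : 'I_n.-1, (max_rank L <= j)%N ==> (seq_exponents d 0 j == 0%N)].
  apply/forallP => j; apply/implyP => rj; rewrite /seq_exponents subn0 if_same addn0.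
  by rewrite ifN // -lt0n (leq_trans r0).
have bE : (fun j : factor_below n (max_rank L) => @seq_exponents n d 0 (val j)) =
    (fun j => if val (val j) == 0%N then d else 0%N).
  by apply: funext => j; rewrite /seq_exponents subn0 if_same addn0.
rewrite bE; apply: intersection_number_eq.
  move=> j; apply: (@factor_minors_inhab K n _ (rank_locus (max_rank L) L)).
  by apply: covers_sym => M [/symL].
case: (leqP n 1) => n1; first exact: (general_num_points_no_factor dimL).
by apply: (general_num_points_first symL dimL); lia.
Qed.

Section AlgebraMatrices.
Variables (K : fieldType) (A : falgType K).
Hypothesis mulC : commutative (@GRing.mul A).
Variable e : (\dim {:A}).-tuple A.
Hypothesis e_basis : basis_of {:A} e.
Local Notation n := (\dim {:A}).

Let e_free : free e. Proof. exact: basis_free e_basis. Qed.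

Lemma dim_alg_gt0 : (0 < n)%N.
Proof.
rewrite lt0n dimv_eq0 -subv0; apply/negP => /subvP/(_ 1 (memvf _)).
by rewrite memv0 oner_eq0.
Qed.

Lemma expand_basis (x : A) : x = \sum_(i < n) coord e i x *: e`_i.
Proof. exact: (coord_basis e_basis (memvf x)). Qed.

Definition vec_of (y : 'rV[K]_n) : A := \sum_(i < n) y 0 i *: e`_i.

Lemma coord_vec_of y i : coord e i (vec_of y) = y 0 i.
Proof. exact: coord_sum_free. Qed.

Lemma mem_form_space M :
  reflect (exists lam : 'Hom(A, K^o), M = form_mx e lam) (M \in form_space e).
Proof.
apply: (iffP memv_imgP) => [[lam _ ->]|[lam ->]]; exists lam; rewrite ?lfunE ?memvf //.
Qed.

Lemma mem_mult_space M :
  reflect (exists a : A, M = mult_mx e a) (M \in mult_space e).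
Proof.
by apply: (iffP memv_imgP) => [[a _ ->]|[a ->]]; exists a; rewrite ?lfunE ?memvf.
Qed.

Lemma form_mx_inj : injective (form_mx e).
Proof.
move=> l1 l2 E; apply/lfunP => x.
have key i (y : A) : l1 (e`_(i : 'I_n) * y) = l2 (e`_i * y).
  rewrite [y]expand_basis !mulr_sumr !linear_sum; apply: eq_bigr => j _.
  rewrite -!scalerAr !linearZ /=; congr (_ * _).
  by move/matrixP/(_ i j): E; rewrite !mxE.
rewrite -[x]mulr1 [x]expand_basis !mulr_suml !linear_sum; apply: eq_bigr => i _.
by rewrite -!scalerAl !linearZ /= key.
Qed.

Lemma dim_form_space : \dim (form_space e) = n.
Proof.
rewrite /form_space limg_dim_eq; first by rewrite !dimvf /dim /= muln1.
rewrite (_ : lker _ = 0%VS) ?capv0 //; apply/eqP/lker0P => x y.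
by rewrite !lfunE => /form_mx_inj.
Qed.

Lemma form_mx_sym lam : (form_mx e lam)^T = form_mx e lam.
Proof. by apply/matrixP => i j; rewrite !mxE mulC. Qed.

Lemma form_mx_vec (lam : 'Hom(A, K^o)) y j :
  (y *m form_mx e lam) 0 j = lam (vec_of y * e`_j).
Proof.
rewrite mxE mulr_suml linear_sum; apply: eq_bigr => i _.
by rewrite mxE -scalerAl linearZ.
Qed.

Lemma form_mx_kernel (lam : 'Hom(A, K^o)) y :
  y *m form_mx e lam = 0 <-> (forall x, lam (vec_of y * x) = 0).
Proof.
split=> [h x|h]; last by apply/rowP => j; rewrite form_mx_vec h mxE.
rewrite [x]expand_basis mulr_sumr linear_sum big1 // => j _.
by rewrite -scalerAr linearZ /= -form_mx_vec h mxE scaler0.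
Qed.

(** With an invertible form matrix this is the change of coordinates between the two spaces of
    matrices. *)
Lemma mult_mx_form (lam : 'Hom(A, K^o)) a :
  mult_mx e a *m form_mx e lam = form_mx e (lam \o amull a)%VF.
Proof.
apply/matrixP => i j; rewrite !mxE lfunE /= lfunE /= mulrA.
rewrite [in RHS](expand_basis (a * e`_i)) mulr_suml linear_sum.
by apply: eq_bigr => k _; rewrite !mxE -scalerAl linearZ.
Qed.

Lemma mult_mx1 : mult_mx e 1 = 1%:M.
Proof.
by apply/matrixP => i j; rewrite !mxE mul1r coord_free.
Qed.

Lemma mult_mxM a b : mult_mx e (a * b) = mult_mx e b *m mult_mx e a.
Proof.
apply/matrixP => i j; rewrite !mxE -mulrA [in LHS](expand_basis (b * e`_i)).
rewrite mulr_sumr linear_sum; apply: eq_bigr => k _.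
by rewrite !mxE -scalerAr linearZ.
Qed.

Lemma dim_mult_space : \dim (mult_space e) = n.
Proof.
rewrite /mult_space limg_dim_eq //.
rewrite (_ : lker _ = 0%VS) ?capv0 //; apply/eqP/lker0P => x y.
rewrite !lfunE => /matrixP E; rewrite -[x]mulr1 -[y]mulr1 [1]expand_basis !mulr_sumr.
apply: eq_bigr => i _; rewrite -!scalerAr; congr (_ *: _).
rewrite [LHS]expand_basis [RHS]expand_basis; apply: eq_bigr => j _.
by have := E i j; rewrite !mxE => ->.
Qed.

(** An invertible multiplication matrix means that [a] is no zero divisor; in finite dimension [a]
    then has an inverse in the algebra, whose multiplication matrix is the one sought. *)
Lemma mult_space_invmx M :
  M \in mult_space e -> M \in unitmx -> invmx M \in mult_space e.
Proof.
case/mem_mult_space => a -> ua.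
have a0 b : a * b = 0 -> b = 0.
  move=> ab; have /row_free_inj inj : row_free (mult_mx e a) by rewrite row_free_unit.
  have : mult_mx e b *m mult_mx e a = 0 *m mult_mx e a.
    by rewrite -mult_mxM ab mul0mx; apply/matrixP => i j; rewrite !mxE mul0r linear0.
  move/inj => /matrixP E.
  rewrite -[b]mulr1 [1]expand_basis mulr_sumr big1 // => i _.
  rewrite -scalerAr [b * _]expand_basis big1 ?scaler0 // => j _.
  by have := E i j; rewrite !mxE => ->; rewrite scale0r.
have [b ab] : exists b, a * b = 1.
  have : lker (amull a) == 0%VS.
    apply/lker0P => x y; rewrite !lfunE /= => h; apply/eqP; rewrite -subr_eq0.
    by apply/eqP/a0; rewrite mulrBr h subrr.
  move=> k0; have := lker0_lfunVK k0 (1 : A).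
  by rewrite lfunE => <-; eexists; reflexivity.
apply/mem_mult_space; exists b; apply: (can_inj (mulKmx ua)).
by rewrite mulmxV // -mult_mxM mulC ab mult_mx1.
Qed.

Lemma gorenstein_form_unit : gorenstein A ->
  exists2 lam : 'Hom(A, K^o), form_mx e lam \in unitmx &
    forall mu : 'Hom(A, K^o), exists a, mu = (lam \o amull a)%VF.
Proof.
case=> lam [bf _]; exists lam; last first.
  by move=> mu; case: bf => g _ fg; exists (g mu); rewrite fg.
have inj := bij_inj bf; rewrite -row_free_unit.
apply/row_freeP; have : kermx (form_mx e lam) == 0.
  apply/eqP/row_matrixP => i; rewrite row0.
  have /form_mx_kernel h : row i (kermx (form_mx e lam)) *m form_mx e lam = 0.
    by rewrite -row_mul mulmx_ker row0.
  suff y0 : vec_of (row i (kermx (form_mx e lam))) = 0.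
    by apply/rowP => j; rewrite -coord_vec_of y0 linear0 mxE.
  apply: inj; apply/lfunP => x; rewrite !comp_lfunE /= !lfunE /= mul0r linear0.
  exact: h.
by rewrite kermx_eq0 => /row_freeP.
Qed.

(** Nondegeneracy makes the map to the dual injective, hence bijective by dimension; commutativity
    yields the other side. *)
Lemma form_unit_gorenstein (lam : 'Hom(A, K^o)) :
  form_mx e lam \in unitmx -> gorenstein A.
Proof.
move=> u.
pose f (a : A) := (lam \o amull a)%VF.
have fl : linear f.
  move=> c a b; apply/lfunP => x; rewrite lfunE /= !lfunE /= lfunE /= !lfunE /=.
  by rewrite mulrDl linearD -scalerAl linearZ !lfunE.
pose fM := GRing.isLinear.Build K A 'Hom(A, K^o) *:%R f fl.
pose fL : {linear A -> 'Hom(A, K^o)} := HB.pack f fM.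
pose g : 'Hom(A, 'Hom(A, K^o)) := linfun fL.
have gE a : g a = f a by rewrite lfunE.
have k0 : lker g == 0%VS.
  apply/lker0P => a b; rewrite !gE => fab.
  apply/eqP; rewrite -subr_eq0; apply/eqP; set c := a - b.
  have cE : c = vec_of (\row_i coord e i c).
    by rewrite [LHS]expand_basis; apply: eq_bigr => i _; rewrite mxE.
  have : (\row_i coord e i c) *m form_mx e lam = 0.
    apply/form_mx_kernel => x; rewrite -cE mulrBl linearB.
    by have /lfunP/(_ x) := fab; rewrite !comp_lfunE /= !lfunE /= => ->; rewrite subrr.
  move=> h; rewrite cE; have -> : \row_i coord e i c = 0.
    by rewrite -[LHS](mulmxK u) h mul0mx.
  by rewrite /vec_of big1 // => i _; rewrite mxE scale0r.
have dimg : limg g = fullv.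
  apply/eqP; rewrite eqEdim subvf limg_dim_eq ?(eqP k0) ?capv0 //.
  by rewrite !dimvf /dim /= muln1.
have bf : bijective f.
  exists (g^-1)%VF => x; first by rewrite -gE lker0_lfunK.
  by rewrite -gE limg_lfunVK // dimg memvf.
exists lam; split=> //.
suff <- : f = (fun b : A => (lam \o amulr b)%VF) by [].
by apply: funext => b; apply/lfunP => x; rewrite !comp_lfunE /= !lfunE /= mulC.
Qed.

End AlgebraMatrices.

(** * Cofactors as coordinates *)


Section CofactorIndices.
Variables (n i : nat).

Lemma minor_idx_sorted (I : minor_idx n i) :
  sorted ltn (map val (codom (val I))).
Proof.
rewrite /codom /image_mem -map_comp sorted_map /=.
have : sorted (relpre val ltn) (enum 'I_i) by rewrite -sorted_map val_enum_ord iota_ltn_sorted.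
apply: sub_sorted => a b ab; case: I => f /= /forallP/(_ a)/forallP/(_ b)/implyP; exact.
Qed.

Lemma minor_idx_codom (I J : minor_idx n i) :
  codom (val I) =i codom (val J) -> I = J.
Proof.
move=> IJ; apply/val_inj/ffunP => a.
have e : map val (codom (val I)) = map val (codom (val J)) :> seq nat.
  apply: (irr_sorted_eq ltn_trans ltnn); try exact: minor_idx_sorted.
  by move=> x; apply/mapP/mapP => -[y yI ->]; exists y; rewrite ?IJ // -IJ.
have {}e : codom (val I) = codom (val J) by apply: (inj_map val_inj e).
by move/eq_in_map: e; apply; rewrite mem_enum.
Qed.

End CofactorIndices.

Section SkipIndex.
Variable m : nat.

Fact skip_idx_subproof (k : 'I_m.+2) :
  [forall a : 'I_m.+1, forall b : 'I_m.+1, (a < b)%N ==>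
    ([ffun a : 'I_m.+1 => lift k a] a < [ffun a : 'I_m.+1 => lift k a] b)%N].
Proof.
apply/forallP => a; apply/forallP => b; apply/implyP => ab; rewrite !ffunE /= /bump.
by case: (leqP k a); case: (leqP k b); lia.
Qed.

(** The complement of [k]; these index the minors that are cofactors up to sign. *)
Definition skip_idx (k : 'I_m.+2) : minor_idx m.+2 m.+1 :=
  exist _ [ffun a => lift k a] (skip_idx_subproof k).

Lemma skip_idxP (I : minor_idx m.+2 m.+1) : exists k, I = skip_idx k.
Proof.
have [k kI] : exists k, k \notin codom (val I).
  apply: contrapT => /forallNP h.
  have := card_codom (@minor_idx_inj _ _ I); rewrite card_ord.
  rewrite (@eq_card _ _ 'I_m.+2) ?card_ord => [/eqP|k]; first by rewrite eqn_leq ltnn.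
  by have /negP/negPn -> := h k.
exists k; apply: minor_idx_codom; apply/subset_cardP.
  by rewrite !card_codom //; exact: minor_idx_inj.
apply/fintype.subsetP => x xI.
have kx : k != x by apply: contraNneq kI => ->.
have [a xa _] := unlift_some kx.
by rewrite (_ : x = val (skip_idx k) a) ?codom_f //= ffunE.
Qed.

Lemma minor_skip_idx (K : fieldType) (M : 'M[K]_m.+2) k l :
  minor (skip_idx k) (skip_idx l) M = (-1) ^+ (k + l) * cofactor M k l.
Proof.
rewrite /cofactor mulrA -expr2 sqrr_sign mul1r; congr (\det _).
by apply/matrixP => a b; rewrite !mxE !ffunE.
Qed.

Definition cof_coord (k l : 'I_m.+2) : minor_coord (@sym_minors m.+2) m.+1 :=
  match leqP (enum_rank (skip_idx k)) (enum_rank (skip_idx l)) with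
  | LeqNotGtn kl => exist _ (skip_idx k, skip_idx l) kl
  | GtnNotLeq lk => exist _ (skip_idx l, skip_idx k) (ltnW lk)
  end.

Lemma skip_idx_inj : injective skip_idx.
Proof.
move=> k l kl; apply/eqP/negPn/negP => nkl; have [a la _] := unlift_some nkl.
have := neq_lift l a; rewrite {1}la.
have : val (skip_idx k) a = val (skip_idx l) a by rewrite kl.
by rewrite /= !ffunE => ->; rewrite eqxx.
Qed.

Lemma skip_idx_pair_inj p q p' q' :
  (skip_idx p, skip_idx q) = (skip_idx p', skip_idx q') -> p = p' /\ q = q'.
Proof.
move=> pq; split; apply: skip_idx_inj.
  exact: (congr1 fst pq).
exact: (congr1 snd pq).
Qed.

Lemma cof_coordP (t : minor_coord (@sym_minors m.+2) m.+1) :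
  exists k l, t = cof_coord k l /\ val t = (skip_idx k, skip_idx l).
Proof.
case: t => -[I J] IJ; have [k Ik] := skip_idxP I; have [l Jl] := skip_idxP J.
subst I J; exists k, l; split=> //; apply: val_inj => /=; rewrite /cof_coord.
case: leqP => //= lk; by have := IJ; rewrite inE /= leqNgt lk.
Qed.

Lemma val_cof_coord k l : val (cof_coord k l) = (skip_idx k, skip_idx l) \/
  val (cof_coord k l) = (skip_idx l, skip_idx k).
Proof. by rewrite /cof_coord; case: leqP => h; [left | right]. Qed.

Lemma cof_coordC k l : cof_coord k l = cof_coord l k.
Proof.
apply: val_inj; rewrite /cof_coord; case: leqP => kl; case: leqP => lk //=.
  have e : enum_rank (skip_idx k) = enum_rank (skip_idx l).
    by apply: val_inj; apply/eqP; rewrite eqn_leq kl.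
  by rewrite (enum_rank_inj e).
by have := ltn_trans kl lk; rewrite ltnn.
Qed.

End SkipIndex.

(** * Singular spaces with kernels in a plane *)


(** A common zero of the two linear forms is proportional to their cross product, and the nonzero
    quantity says that this is off the conic. On the parametrization (s^2, st, t^2) it is the
    resultant of two binary quadratics. *)
Lemma conic_pencil_eq0 (K : fieldType) (q1 q2 q3 a b c a' b' c' : K) :
  q1 * a + q2 * b + q3 * c = 0 -> q1 * a' + q2 * b' + q3 * c' = 0 ->
  q1 * q3 = q2 ^+ 2 ->
  (c * a' - c' * a) ^+ 2 - (b * c' - b' * c) * (a * b' - a' * b) != 0 ->
  [/\ q1 = 0, q2 = 0 & q3 = 0].
Proof.
move=> e e' qq res; pose f1 := q1 * a + q2 * b + q3 * c.
pose f2 := q1 * a' + q2 * b' + q3 * c'.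
have h : f1 = 0 /\ f2 = 0 by [].
have sq0 (x : K) : x ^+ 2 * ((c * a' - c' * a) ^+ 2 -
    (b * c' - b' * c) * (a * b' - a' * b)) = 0 -> x = 0.
  by move/eqP; rewrite mulf_eq0 (negPf res) orbF sqrf_eq0 => /eqP.
have e12 : q1 * (c * a' - c' * a) = q2 * (b * c' - b' * c).
  have : c * f2 - c' * f1 = 0 by rewrite h.1 h.2 !mulr0 subr0.
  by rewrite /f1 /f2 => {}h; apply/eqP; rewrite -subr_eq0 -h; apply/eqP; ring.
have e23 : q2 * (a * b' - a' * b) = q3 * (c * a' - c' * a).
  have : a * f2 - a' * f1 = 0 by rewrite h.1 h.2 !mulr0 subr0.
  by rewrite /f1 /f2 => {}h; apply/eqP; rewrite -subr_eq0 -h; apply/eqP; ring.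
have e13 : q1 * (a * b' - a' * b) = q3 * (b * c' - b' * c).
  have : b * f2 - b' * f1 = 0 by rewrite h.1 h.2 !mulr0 subr0.
  move=> {}h; apply/eqP; rewrite -subr_eq0 -oppr_eq0 -h; apply/eqP.
  by rewrite /f1 /f2; ring.
set c1 := b * c' - b' * c in e12 e13 sq0; set c2 := c * a' - c' * a in e12 e23 sq0.
set c3 := a * b' - a' * b in e13 e23 sq0.
split; apply: sq0.
- have -> : q1 ^+ 2 * (c2 ^+ 2 - c1 * c3) = (q1 * c2) ^+ 2 - q1 * c1 * (q1 * c3) by ring.
  rewrite e12 e13; have -> : q1 * c1 * (q3 * c1) = q1 * q3 * c1 ^+ 2 by ring.
  by rewrite qq; ring.
- have -> : q2 ^+ 2 * (c2 ^+ 2 - c1 * c3) = q2 ^+ 2 * c2 ^+ 2 - (q2 * c1) * (q2 * c3) by ring.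
  rewrite -e12 e23; have -> : q1 * c2 * (q3 * c2) = q1 * q3 * c2 ^+ 2 by ring.
  by rewrite qq; ring.
- have -> : q3 ^+ 2 * (c2 ^+ 2 - c1 * c3) = (q3 * c2) ^+ 2 - q3 * c3 * (q3 * c1) by ring.
  rewrite -e23 -e13; have -> : q3 * c3 * (q1 * c3) = q1 * q3 * c3 ^+ 2 by ring.
  by rewrite qq; ring.
Qed.

Lemma polyfun_cross_resultant (K : fieldType) (F : finType) (T : F -> finType)
    (a b c a' b' c' : mvec K T -> K) :
  polyfun a -> polyfun b -> polyfun c -> polyfun a' -> polyfun b' -> polyfun c' ->
  polyfun (fun x => (c x * a' x - c' x * a x) ^+ 2 -
    (b x * c' x - b' x * c x) * (a x * b' x - a' x * b x)).
Proof.
move=> pa pb pc pa' pb' pc'.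
have psub (f g : mvec K T -> K) : polyfun f -> polyfun g -> polyfun (fun x => f x - g x).
  move=> pf pg; apply: polyfun_add => //.
  have := polyfun_mul (polyfun_const _ (-1)) pg.
  by apply: polyfun_ext => h; rewrite mulN1r.
have pcross (f g f' g' : mvec K T -> K) : polyfun f -> polyfun g -> polyfun f' -> polyfun g' ->
    polyfun (fun x => f x * g x - f' x * g' x).
  by move=> pf pg pf' pg'; exact: (psub _ _ (polyfun_mul pf pg) (polyfun_mul pf' pg')).
exact: (psub _ _ (polyfun_exp 2 (pcross _ _ _ _ pc pa' pc' pa))
  (polyfun_mul (pcross _ _ _ _ pb pc' pb' pc) (pcross _ _ _ _ pa pb' pa' pb))).
Qed.

Lemma general_num_points_empty (K : numFieldType) (F : finType) (T : F -> finType)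
    (b : F -> nat) (X : set (mvec K T)) (f : hyps K T b -> K) c :
  (forall j, T j) -> polyfun f -> (exists h, f h != 0) ->
  (forall h x, f h != 0 -> ~ hyp_section X h x) ->
  general_num_points b X c -> c = 0%N.
Proof.
move=> t0 [P PE] [h0 fh0] fX [G G0 Gc].
have P0 : P != 0.
  by apply: contraNneq fh0 => P0; rewrite -PE P0 /mvec_eval meval0.
(* At a common point of both open sets the section is empty and has [c] points. *)
have [|h ph] := mproj_point_eval_neq0 _ (mulf_neq0 G0 P0); first by move=> s; exact: t0.
rewrite /mvec_eval mevalM mulf_eq0 negb_or => /andP[Gh].
rewrite -[X in X != 0]/(mvec_eval P h) PE => /fX he.
have [p [hp _ _]] := Gc h ph Gh; case: c p hp {Gc} => // c p hp.
by case: (he _ (hp 0)).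
Qed.

Lemma det_mx2 (K : comNzRingType) (N : 'M[K]_2) :
  \det N = N 0 0 * N 1 1 - N 0 1 * N 1 0.
Proof.
have l1 : lift 0 (0 : 'I_1) = 1 :> 'I_2 by apply: val_inj.
have l0 : lift 1 (0 : 'I_1) = 0 :> 'I_2 by apply: val_inj.
rewrite (expand_det_row _ 0) !big_ord_recl big_ord0 addr0.
rewrite /cofactor !det_mx11 !mxE /= !l1 l0.
by rewrite expr0 expr1 mul1r mulN1r mulrN.
Qed.

Section LastTerm.
Variables (K : numFieldType) (m d : nat) (L : {vspace 'M[K]_m.+2}).
Hypotheses (symL : forall M, M \in L -> M^T = M) (d_gt1 : (1 < d)%N).
Variables (W : 'M[K]_(2, m.+2)) (R : 'M[K]_(m.+2, 2)).
Hypotheses (WR : W *m R = 1%:M)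
  (singL : forall M, M \in L -> M \notin unitmx)
  (kerL : forall M, M \in L -> \rank M = m.+1 -> (kermx M <= W)%MS).

Local Notation Dsym := (@sym_minors m.+2).

Section FullFactors.
Let r := m.+1.
Local Notation T := (@factor_minors m.+2 Dsym r).
Local Notation S := (rank_locus r L).

Let jl : factor_below m.+2 r := exist _ (Ordinal (ltnSn m)) (ltnSn m).
Let b (j : factor_below m.+2 r) : nat := @seq_exponents m.+2 d d (val j).

Let bjl : b jl = d.
Proof. by rewrite /b /seq_exponents /= eqxx subnn if_same. Qed.

(** The signs turn the largest minors into cofactors, so [Y] gives [\adj M] on the image of [M]; by
    symmetry the order of [k] and [l] is immaterial. *)
Let Y (x : mvec K T) : 'M[K]_m.+2 :=
  \matrix_(k, l) ((-1) ^+ (k + l) * x jl (cof_coord k l)).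

Let Ysym x : (Y x)^T = Y x.
Proof. by apply/matrixP => k l; rewrite !mxE cof_coordC addnC. Qed.

Let YE M : M \in L -> Y (minor_map Dsym r M) = \adj M.
Proof.
move=> ML; apply/matrixP => k l; rewrite mxE ffunE [RHS]mxE /coord_minor.
have cofC k' l' : cofactor M k' l' = cofactor M l' k'.
  have := trmx_adj M; rewrite (symL ML) => /matrixP/(_ k' l').
  by rewrite !mxE.
have [] := val_cof_coord k l => -> /=; rewrite minor_skip_idx.
  by rewrite mulrA -expr2 sqrr_sign mul1r cofC.
by rewrite (addnC l) mulrA -expr2 sqrr_sign mul1r.
Qed.

Let Yhom k l : mhomfun (fun j => nat_of_bool (jl == j)) (fun x => Y x k l).
Proof.
have := mhomfunZ ((-1) ^+ (k + l)) (@mhomfun_coord K _ T jl (cof_coord k l)).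
by apply: mhomfun_ext => // x; rewrite mxE.
Qed.

Let Q x : 'M[K]_2 := R^T *m Y x *m R.

Let Qsym x : (Q x)^T = Q x.
Proof. by rewrite /Q !trmx_mul trmxK Ysym mulmxA. Qed.

Let mulYhom p q (A : 'M[K]_(p, m.+2)) (B : 'M[K]_(m.+2, q)) k l :
  mhomfun (fun j => nat_of_bool (jl == j)) (fun x => (A *m Y x *m B) k l).
Proof.
apply: (@mhomfun_ext _ _ _ (fun j => nat_of_bool (jl == j)) _
  (fun x => \sum_i B i l * \sum_i' A k i' * Y x i' i)) => //.
  by move=> x; rewrite mxE; apply: eq_bigr => i _; rewrite mulrC mxE.
by apply: mhomfun_sum => i _; apply: mhomfunZ; apply: mhomfun_sum => i' _; apply: mhomfunZ.
Qed.

Let detL M : M \in L -> \det M = 0.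
Proof. by move/singL; rewrite unitmxE unitfE negbK => /eqP. Qed.

Let rankS M : S M -> (m.+1 <= \rank M)%N.
Proof. by case=> _ _; apply: leq_trans; rewrite leq_min !leqnn. Qed.

(** The rows of [\adj M] lie in the kernel of [M], hence in [W], on which [R *m W] acts as the
    identity; symmetry gives the same for columns. *)
Let adjW M : S M -> W^T *m (R^T *m \adj M *m R) *m W = \adj M.
Proof.
move=> MS; have rM := rankS MS; case: MS => ML _ _.
have {}rM : \rank M = m.+1.
  apply/eqP; rewrite eqn_leq rM andbT -ltnS ltn_neqAle rank_leq_row andbT.
  by apply: contra (singL ML) => /eqP e; rewrite -row_free_unit /row_free e.
have aW : \adj M *m R *m W = \adj M.
  have : (\adj M <= W)%MS.
    apply: submx_trans (kerL ML rM); apply/sub_kermxP.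
    by rewrite mul_adj_mx detL // raddf0.
  by case/submxP => D ->; rewrite -(mulmxA D) WR mulmx1.
have Wa : W^T *m R^T *m \adj M = \adj M.
  have := congr1 trmx aW; rewrite !trmx_mul trmx_adj (symL ML) -mulmxA.
  by rewrite mulmxA.
by rewrite !mulmxA Wa aW.
Qed.

(** As [\adj M *m M = 0] with [M] of corank 1, the adjugate has rank at most 1. *)
Let detQ M : S M -> \det (R^T *m \adj M *m R) = 0.
Proof.
move=> MS; have rM := rankS MS; case: MS => ML _ _.
apply/eqP/negPn/negP; rewrite -unitfE -[_ \is a _]/(_ \in unitmx) => /mxrank_unit.
move=> r2; have : (2 <= \rank (\adj M))%N.
  by rewrite -r2 (leq_trans (mxrankM_maxl _ _)) // mxrankM_maxr.
have := mulmx0_rank_max (B := M) (A := \adj M).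
by rewrite mul_adj_mx detL // raddf0 => /(_ erefl); lia.
Qed.

Let YQ x : zclosure (minor_map Dsym r @` S) x -> Y x = W^T *m Q x *m W.
Proof.
move=> Xx; apply/matrixP => k l; apply/eqP; rewrite -subr_eq0; apply/eqP.
apply: (@zclosure_mhomfun _ _ _ _ (fun j => nat_of_bool (jl == j))
  (fun x => Y x k l - (W^T *m Q x *m W) k l) _ _ _ Xx).
  apply: mhomfun_add => //.
  have := mhomfunZ (-1) (mulYhom (W^T *m R^T) (R *m W) k l).
  by apply: mhomfun_ext => // z; rewrite mulN1r /Q !mulmxA.
move=> _ [M MS <-]; case: (MS) => ML _ _.
by rewrite /Q YE // adjW // subrr.
Qed.

Let Q_conic x : zclosure (minor_map Dsym r @` S) x -> Q x 0 0 * Q x 1 1 = Q x 0 1 ^+ 2.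
Proof.
move=> Xx; apply/eqP; rewrite -subr_eq0; apply/eqP.
apply: (@zclosure_mhomfun _ _ _ _ (fun j => nat_of_bool (jl == j) + nat_of_bool (jl == j))%N
  (fun x => Q x 0 0 * Q x 1 1 - Q x 0 1 ^+ 2) _ _ _ Xx).
  apply: mhomfun_add; first exact: (mhomfun_mul (mulYhom _ _ _ _) (mulYhom _ _ _ _)).
  have := mhomfunZ (-1) (mhomfun_mul (mulYhom R^T R 0 1) (mulYhom R^T R 0 1)).
  by apply: mhomfun_ext => // z; rewrite mulN1r expr2.
move=> _ [M MS <-]; case: (MS) => ML _ _.
have QM : Q (minor_map Dsym r M) = R^T *m \adj M *m R by rewrite /Q YE.
have := detQ MS; rewrite -QM; set N := Q _ => N0.
have Nsym : N 1 0 = N 0 1 by rewrite /N -[in LHS]Qsym mxE.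
by rewrite -[RHS]N0 det_mx2 Nsym expr2.
Qed.

Let kl : forall t : T jl, {p : 'I_m.+2 * 'I_m.+2 | t = cof_coord p.1 p.2}.
Proof.
move=> t; apply: cid; have [k [l [e _]]] := cof_coordP t.
by exists (k, l).
Qed.

Let zvec (E : 'M[K]_2) (t : T jl) : K :=
  (-1) ^+ ((sval (kl t)).1 + (sval (kl t)).2) *
  (W^T *m E *m W) (sval (kl t)).1 (sval (kl t)).2.

Let zvecE x t : Y x = W^T *m Q x *m W -> x jl t = zvec (Q x) t.
Proof.
move=> YQx; rewrite /zvec -YQx mxE -(svalP (kl t)) mulrA -expr2 sqrr_sign.
by rewrite mul1r.
Qed.

Let zvecD E E' t : zvec (E + E') t = zvec E t + zvec E' t.
Proof. by rewrite /zvec mulmxDr mulmxDl mxE mulrDr. Qed.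

Let zvecZ c E t : zvec (c *: E) t = c * zvec E t.
Proof. by rewrite /zvec -scalemxAr -scalemxAl mxE mulrCA. Qed.

Let E1 : 'M[K]_2 := delta_mx 0 0.
Let E2 : 'M[K]_2 := delta_mx 0 1 + delta_mx 1 0.
Let E3 : 'M[K]_2 := delta_mx 1 1.

Let sym_mx2 (N : 'M[K]_2) : N^T = N ->
  N = N 0 0 *: E1 + N 0 1 *: E2 + N 1 1 *: E3.
Proof.
move=> Nsym; have N10 : N 1 0 = N 0 1 by rewrite -[in LHS]Nsym mxE.
apply/matrixP => a c; rewrite !mxE.
have ord2 (u : 'I_2) : u = 0 \/ u = 1.
  by case: u => -[|[|//]] lu; [left | right]; apply: val_inj.
have e10 : ((1 : 'I_2) == 0) = false by [].
have e01 : ((0 : 'I_2) == 1) = false by [].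
have [->|->] := ord2 a; have [->|->] := ord2 c; rewrite ?eqxx ?e10 ?e01 ?N10 /=;
  by rewrite !(mulr1, mulr0, addr0, add0r).
Qed.

(** Two of the [d] hyperplanes in the last factor; they already suffice to make the section
    empty. *)
Let s_ (i : 'I_2) : {j : factor_below m.+2 r & 'I_(b j)} :=
  existT (fun j => 'I_(b j)) jl (cast_ord (esym bjl) (widen_ord d_gt1 i)).

Let pairing (h : hyps K T b) i E : K := \sum_(t : T jl) h (s_ i) t * zvec E t.

Let resultant (h : hyps K T b) : K :=
  (pairing h 0 E3 * pairing h 1 E1 - pairing h 1 E3 * pairing h 0 E1) ^+ 2 -
  (pairing h 0 E2 * pairing h 1 E3 - pairing h 1 E2 * pairing h 0 E3) *
  (pairing h 0 E1 * pairing h 1 E2 - pairing h 1 E1 * pairing h 0 E2).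

Lemma empty_hyp_section (h : hyps K T b) x : resultant h != 0 ->
  ~ hyp_section (zclosure (minor_map Dsym r @` S)) h x.
Proof.
move=> res [Xx hx]; have YQx := YQ Xx.
have xE t : x jl t = Q x 0 0 * zvec E1 t + Q x 0 1 * zvec E2 t + Q x 1 1 * zvec E3 t.
  by rewrite -!zvecZ -!zvecD -sym_mx2 ?Qsym //; apply: zvecE.
have pE i : Q x 0 0 * pairing h i E1 + Q x 0 1 * pairing h i E2 +
    Q x 1 1 * pairing h i E3 = 0.
  rewrite -[RHS](hx (s_ i)) /pairing !mulr_sumr -!big_split /=.
  by apply: eq_bigr => t _; rewrite [x jl t]xE; ring.
have [q1 q2 q3] := conic_pencil_eq0 (pE 0) (pE 1) (Q_conic Xx) res.
case: (Xx) => /(_ jl)/eqP nz _; apply: nz; apply/ffunP => t; rewrite xE ffunE.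
by rewrite q1 q2 q3 !mul0r !addr0.
Qed.

Lemma resultant_neq0 : exists h, resultant h != 0.
Proof.
(* The witnesses are the forms sending Z to the value of Z at column [i] of [R]. On [W^T *m E *m W]
   they give [E i i], so they cut the conic by q1 = 0 and q3 = 0, with resultant 1. Summing over
   pairs accounts for (k, l) and (l, k) naming one coordinate. *)
have [a aE] : exists a : 'I_2 -> forall j, T j -> K, forall i (t : T jl),
    a i jl t = \sum_(p : 'I_m.+2 * 'I_m.+2 | cof_coord p.1 p.2 == t)
       (-1) ^+ (p.1 + p.2) * (R p.1 i * R p.2 i).
  have h i := @extend_family K _ T jl (fun t =>
       \sum_(p : 'I_m.+2 * 'I_m.+2 | cof_coord p.1 p.2 == t)
       (-1) ^+ (p.1 + p.2) * (R p.1 i * R p.2 i)).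
  by have /boolp.choice[a aE] := h; exists a.
pose h : hyps K T b := fun s => [ffun t => a (inord (tagged s)) (tag s) t].
have hE i E : E^T = E -> pairing h i E = E i i.
  move=> Esym; rewrite /pairing.
  have -> : E i i = (R^T *m (W^T *m E *m W) *m R) i i.
    by rewrite !mulmxA -mulmxA WR mulmx1 -trmx_mul WR trmx1 mul1mx.
  set Z := W^T *m E *m W.
  have Zsym : Z^T = Z by rewrite /Z !trmx_mul trmxK Esym mulmxA.
  have ZC k l : Z k l = Z l k by rewrite -[in LHS]Zsym mxE.
  have zZ (k l : 'I_m.+2) : (-1) ^+ (k + l) * zvec E (cof_coord k l) = Z k l.
    rewrite /zvec -/Z; have := svalP (kl (cof_coord k l)).
    case: (sval _) => k' l' /= e.
    have sg (u v : 'I_m.+2) z : (-1) ^+ (u + v) * ((-1) ^+ (u + v) * z) = z :> K.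
      by rewrite mulrA -expr2 sqrr_sign mul1r.
    have [e1|e1] := val_cof_coord k l; have [e2|e2] := val_cof_coord k' l';
      move: e1; rewrite e e2 => /skip_idx_pair_inj[-> ->]; rewrite ?sg //;
      by rewrite ZC addnC sg.
  transitivity (\sum_k \sum_l (R k i * R l i) * Z k l).
    have hs t : h (s_ i) t = a i jl t.
      by rewrite ffunE (_ : inord _ = i) //; apply: val_inj; rewrite /= inordK.
    under eq_bigr => t _ do rewrite hs aE mulr_suml.
    rewrite pair_big /= [RHS](partition_big (fun p => cof_coord p.1 p.2) predT) //=.
    apply: eq_bigr => t _; apply: eq_bigr => -[k l] /= /eqP <-.
    by rewrite -zZ [RHS]mulrCA [RHS]mulrA.
  rewrite [RHS]mxE exchange_big; apply: eq_bigr => l _.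
  rewrite mxE mulr_suml; apply: eq_bigr => k _; rewrite [R^T i k]mxE.
  by rewrite mulrAC.
have E1s : E1^T = E1 by rewrite /E1 trmx_delta.
have E3s : E3^T = E3 by rewrite /E3 trmx_delta.
have E2s : E2^T = E2 by rewrite /E2 linearD /= !trmx_delta addrC.
exists h; rewrite /resultant !hE // !mxE /=.
by rewrite !(mulr0, mul0r, subr0, sub0r, mulr1, addr0, sqrrN, expr1n) oner_neq0.
Qed.

Lemma polyfun_resultant : polyfun resultant.
Proof.
have ppair i E : polyfun (fun h => pairing h i E).
  apply: polyfun_sum => t; apply: polyfun_mul; last exact: polyfun_const.
  exact: polyfun_coord.
exact: (polyfun_cross_resultant (ppair 0 E1) (ppair 0 E2) (ppair 0 E3)
  (ppair 1 E1) (ppair 1 E2) (ppair 1 E3)).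
Qed.

Lemma general_num_points_last c :
  general_num_points b (zclosure (minor_map Dsym r @` S)) c -> c = 0%N.
Proof.
apply: (general_num_points_empty _ polyfun_resultant resultant_neq0).
  move=> j; apply: (@factor_minors_inhab K m.+2 _ S); apply: covers_sym.
  by move=> M [/symL].
exact: empty_hyp_section.
Qed.

End FullFactors.

Lemma char_num_last_eq0 : char_num Dsym L (@seq_exponents m.+2 d d) = 0%N.
Proof.
(* If the last factor is absent, its exponent [d] is nonzero and the number is 0 by convention. *)
rewrite char_numE; case: ifP => // /forallP/(_ (Ordinal (ltnSn m))) /implyP guard.
have rm : max_rank L = m.+1.
  apply/eqP; rewrite eqn_leq; apply/andP; split.
    have [M ML <-] := max_rank_attained L.
    rewrite -ltnS ltn_neqAle rank_leq_row andbT.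
    by apply: contra (singL ML) => /eqP e; rewrite -row_free_unit /row_free e.
  rewrite ltnNge; apply/negP => /guard.
  by rewrite /seq_exponents /= eqxx addn_eq0; lia.
rewrite rm /intersection_number; case: xgetP => // c _.
exact: general_num_points_last.
Qed.

End LastTerm.

Lemma char_num_last_singular (K : numFieldType) n d (L : {vspace 'M[K]_n})
    (W : 'M[K]_(2, n)) :
  (forall M, M \in L -> M^T = M) -> (1 < d)%N -> (1 < n)%N -> row_free W ->
  (forall M, M \in L -> M \notin unitmx) ->
  (forall M, M \in L -> \rank M = n.-1 -> (kermx M <= W)%MS) ->
  char_num (@sym_minors n) L (@seq_exponents n d d) = 0%N.
Proof.
case: n L W => [|[|m]] // L W symL d1 _ /row_freeP[R WR] singL kerL.
exact: (char_num_last_eq0 symL d1 WR singL kerL).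
Qed.

(** * The socle of an algebra that is not Gorenstein *)


Lemma rank_adj_neq0 (K : fieldType) n (M : 'M[K]_n) :
  (0 < n)%N -> \rank M = n.-1 -> \adj M != 0.
Proof.
case: n M => [|[|m]] // M _ rM.
  apply/negP => /eqP/matrixP/(_ 0 0)/eqP.
  by rewrite !mxE /cofactor det_mx00 mulr1 signr_eq0.
have [I [J]] := @rank_minor_neq0 K _ m.+1 M (eq_leq (esym rM)).
have [k ->] := skip_idxP I; have [l ->] := skip_idxP J; rewrite minor_skip_idx.
by apply: contraNneq => /matrixP/(_ l k); rewrite !mxE => ->; rewrite mulr0.
Qed.

Lemma adj_neq0_rank (K : fieldType) n (M : 'M[K]_n) k l :
  \adj M k l != 0 -> (n.-1 <= \rank M)%N.
Proof.
rewrite mxE /cofactor mulf_eq0 negb_or => /andP[_].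
rewrite -unitfE -[_ \is a _]/(_ \in unitmx) => /mxrank_unit <-.
rewrite (_ : row' l _ = mxsub (lift l) (lift k) M); first exact: mxrank_mxsub.
by apply/matrixP => a b; rewrite !mxE.
Qed.

Lemma corank1_kermx (K : fieldType) n (M : 'M[K]_n) (y : 'rV[K]_n) :
  (0 < n)%N -> \rank M = n.-1 -> y != 0 -> y *m M = 0 -> (kermx M <= y)%MS.
Proof.
move=> n0 rM y0 yM; have yk : (y <= kermx M)%MS by apply/sub_kermxP.
rewrite -(geq_leqif (mxrank_leqif_sup yk)) mxrank_ker rM rank_rV y0.
by case: (n) n0 => // m _; rewrite /= subSnn.
Qed.

Lemma char_num_last_low_rank (K : fieldType) n d (L : {vspace 'M[K]_n}) :
  (0 < d)%N -> (max_rank L < n.-1)%N ->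
  char_num (@sym_minors n) L (@seq_exponents n d d) = 0%N.
Proof.
move=> d0 mr; rewrite char_numE; case: ifP => // /forallP guard.
have lt : (n.-2 < n.-1)%N by rewrite prednK // (leq_ltn_trans _ mr).
have := guard (Ordinal lt); rewrite /seq_exponents /= -ltnS prednK ?mr ?eqxx.
  by rewrite addn_eq0 => /andP[_]; rewrite eqn0Ngt d0.
exact: leq_ltn_trans mr.
Qed.

Section Socle.
Variables (K : numClosedFieldType) (A : falgType K).
Hypothesis mulC : commutative (@GRing.mul A).
Variable e : (\dim {:A}).-tuple A.
Hypothesis e_basis : basis_of {:A} e.
Local Notation n := (\dim {:A}).

Let e_free : free e. Proof. exact: basis_free e_basis. Qed.

Let n_gt0 : (0 < n)%N. Proof. exact: dim_alg_gt0. Qed.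

Definition row_of (x : A) : 'rV[K]_n := \row_j coord e j x.

Lemma row_ofK x : vec_of e (row_of x) = x.
Proof. by rewrite [RHS](expand_basis e_basis); apply: eq_bigr => i _; rewrite mxE. Qed.

Lemma row_of_eq0 x : (row_of x == 0) = (x == 0).
Proof.
apply/eqP/eqP => [x0|->]; last by apply/rowP => j; rewrite !mxE linear0.
by rewrite -[x]row_ofK x0 /vec_of big1 // => i _; rewrite mxE scale0r.
Qed.

(** [b] and [x] both lie in the radical of the form, which is a line in corank 1. *)
Lemma corank1_ideal (lam : 'Hom(A, K^o)) b x :
  \rank (form_mx e lam) = n.-1 -> b != 0 -> (forall z, lam (b * z) = 0) ->
  (forall z, lam (x * z) = 0) -> exists c, x = c *: b.
Proof.
move=> rk b0 hb hx.
have yb : row_of b *m form_mx e lam = 0.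
  by apply/(form_mx_kernel e_basis) => z; rewrite row_ofK.
have yx : row_of x *m form_mx e lam = 0.
  by apply/(form_mx_kernel e_basis) => z; rewrite row_ofK.
have kb := corank1_kermx n_gt0 rk (_ : row_of b != 0) yb.
have /sub_rVP[c cE] : (row_of x <= row_of b)%MS.
  by apply: submx_trans (kb _); [apply/sub_kermxP | rewrite row_of_eq0].
exists c; rewrite -[x]row_ofK cE -[b in RHS]row_ofK /vec_of scaler_sumr.
by apply: eq_bigr => i _; rewrite mxE scalerA.
Qed.

Lemma row_of_mul a x : row_of x *m mult_mx e a = row_of (a * x).
Proof.
apply/rowP => j; rewrite !mxE [in RHS](expand_basis e_basis x) mulr_sumr linear_sum.
by apply: eq_bigr => i _; rewrite !mxE -scalerAr linearZ.
Qed.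

Lemma eigenvector_root a x c : x != 0 -> a * x = c *: x ->
  root (char_poly (mult_mx e a)) c.
Proof.
move=> x0 ax; rewrite -eigenvalue_root_char; apply/eigenvalueP.
exists (row_of x); last by rewrite row_of_eq0.
by rewrite row_of_mul ax; apply/rowP => j; rewrite !mxE linearZ.
Qed.

Lemma exists_functional (b : A) : b != 0 -> exists mu : 'Hom(A, K^o), mu b = 1.
Proof.
move=> b0; have [i bi] : exists i, coord e i b != 0.
  apply: contrapT => /forallNP h; move/eqP: b0; apply.
  rewrite (expand_basis e_basis b) big1 // => i _.
  by have /negP/negPn/eqP -> := h i; rewrite scale0r.
exists ((coord e i b)^-1 *: linfun (coord e i : A -> K^o)).
by rewrite !lfunE /= lfunE /= /GRing.scale /= mulVf.
Qed.

(* Perturbing lam0 to lam0 + t lam1 moves the kernel b 0 of the form along a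
   curve b t of common eigenvectors; the eigenvalues of multiplication by a
   are finite in number, hence constant along the curve, but the kernel line
   is not, since lam1 (b 0) <> 0. *)
Lemma socle_pair (lam0 : 'Hom(A, K^o)) :
  (forall lam : 'Hom(A, K^o), form_mx e lam \notin unitmx) ->
  \rank (form_mx e lam0) = n.-1 ->
  exists (b0 b1 : A) (chi : A -> K),
    [/\ forall s0 s1, s0 *: b0 + s1 *: b1 = 0 -> s0 = 0 /\ s1 = 0,
        forall a, a * b0 = chi a *: b0 & forall a, a * b1 = chi a *: b1].
Proof.
move=> sing rk0.
(* Row [k] of the adjugate gives a kernel vector that is polynomial in the functional; entry [l]
   detects that it is nonzero. *)
have [k [l kl0]] : exists k l, \adj (form_mx e lam0) k l != 0.
  apply: contrapT => h; case/negP: (rank_adj_neq0 n_gt0 rk0).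
  apply/eqP/matrixP => k l; apply/eqP/negPn/negP => kl.
  by apply: h; exists k, l; move: kl; rewrite [X in _ != X]mxE.
pose b lam := vec_of e (row k (\adj (form_mx e lam))).
have bl lam : coord e l (b lam) = \adj (form_mx e lam) k l.
  by rewrite coord_vec_of // mxE.
have bker (lam : 'Hom(A, K^o)) z : lam (b lam * z) = 0.
  move: z; apply/(form_mx_kernel e_basis); rewrite -row_mul mul_adj_mx.
  have /negPf := sing lam; rewrite unitmxE unitfE => /negbFE/eqP ->.
  by rewrite raddf0 row0.
have beig (lam : 'Hom(A, K^o)) a : exists c, a * b lam = c *: b lam.
  have [b0|b0] := eqVneq (b lam) 0; first by exists 0; rewrite b0 mulr0 scaler0.
  have rk : \rank (form_mx e lam) = n.-1.
    have [j bj] : exists j, \adj (form_mx e lam) k j != 0.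
      apply: contrapT => /forallNP h; move/eqP: b0; apply.
      rewrite /b /vec_of big1 // => j _; rewrite mxE.
      by have /negP/negPn/eqP -> := h j; rewrite scale0r.
    apply/eqP; rewrite eqn_leq (adj_neq0_rank bj) andbT -ltnS prednK //.
    rewrite ltn_neqAle rank_leq_row andbT.
    by apply: contra (sing lam) => /eqP rn; rewrite -row_free_unit /row_free rn.
  by apply: (corank1_ideal rk b0) => z //; rewrite (mulC a) -mulrA bker.
pose b0 := b lam0; have b00 : b0 != 0.
  by apply: contraNneq kl0 => b00; rewrite -bl -/b0 b00 linear0.
have [lam1 lam1b] := exists_functional b00.
pose lam t := lam0 + t *: lam1.
have lam_0 : lam 0 = lam0 by rewrite /lam scale0r addr0.
pose Mp := map_mx polyC (form_mx e lam0) + 'X *: map_mx polyC (form_mx e lam1).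
pose yp j := \adj Mp k j.
have ypE t j : (yp j).[t] = \adj (form_mx e (lam t)) k j.
  have -> : form_mx e (lam t) = map_mx (horner_eval t) Mp.
    rewrite /lam linearD linearZ /Mp.
    apply/matrixP => p q; rewrite !mxE /horner_eval.
    by rewrite hornerD hornerC ['X * _]mulrC hornerMX hornerC [t * _]mulrC.
  by rewrite -map_mx_adj mxE.
have wp0 : yp l != 0.
  by apply: contraNneq kl0 => wp0; rewrite -lam_0 -ypE wp0 horner0.
(* The quotient of [up a] by [yp l] is the eigenvalue of [a] on [b (lam t)], as a rational function
   of [t]. *)
pose up a := \sum_j yp j * (coord e l (a * e`_j))%:P.
have upE a t : (up a).[t] = coord e l (a * b (lam t)).
  rewrite horner_sum [in RHS]/b /vec_of mulr_sumr linear_sum; apply: eq_bigr => j _.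
  by rewrite hornerM hornerC ypE [row _ _ _ _]mxE -scalerAr linearZ.
have wpE t : (yp l).[t] = coord e l (b (lam t)) by rewrite ypE bl.
pose chi a := coord e l (a * b0) / coord e l b0.
have lb0 : coord e l b0 != 0 by rewrite /b0 bl.
have upchi a : up a = chi a *: yp l.
  have [rs rsE] := closed_field_poly_normal (char_poly (mult_mx e a)).
  rewrite (monicP (char_poly_monic _)) scale1r in rsE.
  (* At each [t] the eigenvalue is one of the finitely many roots [r], so the product vanishes
     identically, and one factor is the zero polynomial. *)
  have : yp l * \prod_(r <- rs) (up a - r *: yp l) = 0.
    apply: horner_eq0 => t; rewrite hornerM horner_prod.
    have [bt0|bt0] := eqVneq (b (lam t)) 0; first by rewrite wpE bt0 linear0 mul0r.
    have [c ac] := beig (lam t) a.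
    have := eigenvector_root bt0 ac; rewrite rsE root_prod_XsubC => crs.
    rewrite (big_rem c) //= hornerD hornerN hornerZ upE wpE ac linearZ /=.
    by rewrite subrr mul0r mulr0.
  move/eqP; rewrite mulf_eq0 (negPf wp0) prodf_seq_eq0 => /hasP[r _ /=].
  rewrite subr_eq0 => /eqP ur; rewrite ur; congr (_ *: _); rewrite /chi.
  have := congr1 (horner^~ 0) ur.
  by rewrite hornerZ upE wpE lam_0 -/b0 => ->; rewrite mulfK.
have eig t a : coord e l (b (lam t)) != 0 -> a * b (lam t) = chi a *: b (lam t).
  move=> wt; have [c ac] := beig (lam t) a; rewrite ac; congr (_ *: _).
  have := congr1 (horner^~ t) (upchi a); rewrite hornerZ upE wpE ac linearZ.
  by move/(mulIf wt).
(* The factor ['X] ensures [t != 0]: then [lam t] kills [b (lam t)] but takes the value [t] at [b0],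
   which gives independence. *)
have [t] := horner_neq0 (mulf_neq0 wp0 (negbT (polyX_eq0 K))).
rewrite hornerM hornerX mulf_eq0 negb_or wpE => /andP[wt t0].
exists b0, (b (lam t)), chi; split=> [s0 s1 s|a|a]; last 2 first.
- by have := eig 0 a; rewrite lam_0; apply.
- exact: eig.
have lam_b1 : lam t (b (lam t)) = 0 by rewrite -[b _]mulr1 bker.
have lam_b0 : lam t b0 = t.
  rewrite /lam lfunE /= lfunE /= lam1b -[b0 in lam0 b0]mulr1 bker add0r.
  by rewrite /GRing.scale /= mulr1.
have s00 : s0 = 0.
  have := congr1 (lam t) s; move: (lam t) lam_b1 lam_b0 => mu mu_b1 mu_b0.
  rewrite linearD !linearZ /= mu_b1 linear0 mu_b0.
  by rewrite addr0 linear0 => /eqP; rewrite scaler_eq0 (negPf t0) orbF => /eqP.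
split=> //; move: s; rewrite s00 scale0r add0r => /eqP.
rewrite scaler_eq0 => /orP[/eqP //|/eqP bt0].
by move: wt; rewrite bt0 linear0 eqxx.
Qed.

Lemma char_num_last_not_gorenstein : ~ gorenstein A ->
  char_num (@sym_minors n) (form_space e) (@seq_exponents n n.-1 n.-1) = 0%N.
Proof.
move=> notG.
have sing lam : form_mx e lam \notin unitmx.
  by apply/negP => u; apply: notG; apply: (form_unit_gorenstein mulC e_basis u).
have singL M : M \in form_space e -> M \notin unitmx.
  by case/mem_form_space => lam ->.
have rkL M : M \in form_space e -> (\rank M <= n.-1)%N.
  move=> /singL uM; rewrite -ltnS prednK // ltn_neqAle rank_leq_row andbT.
  by apply: contra uM => /eqP rn; rewrite -row_free_unit /row_free rn.
have symL M : M \in form_space e -> M^T = M.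
  by case/mem_form_space => lam ->; apply: form_mx_sym.
have [[M ML rM]|noM] := pselect (exists2 M, M \in form_space e & \rank M = n.-1); last first.
  have mr : (max_rank (form_space e) < n.-1)%N.
    have [M ML rM] := max_rank_attained (form_space e).
    rewrite ltn_neqAle -rM rkL // andbT; apply/negP => /eqP rn.
    by apply: noM; exists M.
  exact: char_num_last_low_rank (leq_ltn_trans (leq0n _) mr) mr.
case/mem_form_space: ML rM => lam0 -> rk0.
have [b0 [b1 [chi [ind eig0 eig1]]]] := socle_pair sing rk0.
pose W : 'M[K]_(1 + 1, n) := col_mx (row_of b0) (row_of b1).
have row_ofD x y s t : s *: row_of x + t *: row_of y = row_of (s *: x + t *: y).
  by apply/rowP => j; rewrite !mxE linearD !linearZ.
have subW s t : (row_of (s *: b0 + t *: b1)%R <= W)%MS.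
  apply/submxP; exists (row_mx s%:M t%:M : 'rV_(1 + 1)).
  by rewrite /W mul_row_col !mul_scalar_mx row_ofD.
have freeW : row_free W.
  rewrite -kermx_eq0; apply/rowV0P => v /sub_kermxP.
  rewrite /W -[v](@hsubmxK _ 1 1 1) mul_row_col.
  rewrite [lsubmx _]mx11_scalar [rsubmx _]mx11_scalar !mul_scalar_mx row_ofD.
  move/eqP; rewrite row_of_eq0 => /eqP/ind[-> ->].
  by rewrite !raddf0 row_mx0.
have W2 : (2 <= n)%N by have := rank_leq_col W; rewrite (eqP freeW).
apply: (char_num_last_singular (W := W)) => //.
  (* The claim is [1 < n.-1]. In dimension 2 the plane is the whole algebra, each [a] is the scalar
     [chi a], and [b0], [b1] cannot be independent. *)
  rewrite ltn_neqAle andbC; apply/andP; split; first by lia.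
  apply/negP => /eqP n2.
  have fullW : row_full W by rewrite /row_full (eqP freeW); lia.
  have /submxP[D DE] : (row_of 1%R <= W)%MS by apply: submx_full.
  have [s [t st]] : exists s t, D = row_mx s%:M t%:M :> 'rV_(1 + 1).
    exists (lsubmx (D : 'rV_(1 + 1)) 0 0), (rsubmx (D : 'rV_(1 + 1)) 0 0).
    by rewrite -!mx11_scalar hsubmxK.
  have oneE : 1 = s *: b0 + t *: b1.
    by rewrite -[LHS]row_ofK DE st /W mul_row_col !mul_scalar_mx row_ofD row_ofK.
  have scal a : a = chi a *: 1.
    rewrite -[LHS]mulr1 {1}oneE mulrDr -!scalerAr eig0 eig1 [in RHS]oneE scalerDr.
    by rewrite !scalerA ![chi a * _]mulrC.
  have [c1 c0] : chi b1 = 0 /\ - chi b0 = 0.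
    have key c x : c *: x = (c * chi x) *: 1 by rewrite {1}(scal x) scalerA.
    by apply: ind; rewrite key [X in _ + X]key -scalerDl mulNr mulrC subrr scale0r.
  have : b0 = 0 by rewrite (scal b0) -[chi b0]opprK c0 oppr0 scale0r.
  by have := ind 1 0; rewrite scale1r scale0r addr0 => h /h [/eqP]; rewrite oner_eq0.
move=> N /mem_form_space[lam ->] rk.
(* A functional has a nonzero zero in the plane; being a common eigenvector, it lies in the radical
   and spans it. *)
have [s0 [s1 [snz slam]]] :
    exists s0 s1, ~ (s0 = 0 /\ s1 = 0) /\ lam (s0 *: b0 + s1 *: b1) = 0.
  have [l0|l0] := eqVneq (lam b0) 0.
    exists 1, 0; split; first by case=> /eqP; rewrite oner_eq0.
    by rewrite scale1r scale0r addr0.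
  exists (lam b1), (- lam b0); split; first by case=> _ /eqP; rewrite oppr_eq0 (negPf l0).
  by rewrite linearD !linearZ /= /GRing.scale /= mulNr mulrC subrr.
apply: submx_trans (subW s0 s1).
apply: (corank1_kermx n_gt0 rk).
  by rewrite row_of_eq0; apply/eqP => /ind.
apply/(form_mx_kernel e_basis) => x; rewrite row_ofK.
have -> : (s0 *: b0 + s1 *: b1) * x = chi x *: (s0 *: b0 + s1 *: b1).
  by rewrite mulC mulrDr -!scalerAr eig0 eig1 scalerDr !scalerA ![chi x * _]mulrC.
by rewrite linearZ /= slam scaler0.
Qed.

End Socle.

(** * The equivalences *)


Lemma sum_seq_exponents n d i : (i <= d)%N -> d = n.-1 ->
  (\sum_j @seq_exponents n d i j)%N = d.
Proof.
move=> id dn; rewrite /seq_exponents; move: dn id.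
case: (n.-1) => [|q] dn id; first by rewrite big_ord0 dn.
rewrite big_split /= big_ord_recl big1 // big_ord_recr big1 /=; last first.
  by move=> j _; rewrite eqSS ltn_eqF.
by rewrite eqxx addn0 add0n subnK.
Qed.

Lemma seq_exponents_rev n d i : (i <= d)%N -> d = n.-1 ->
  @seq_exponents n d i \o @rev_ord n.-1 = @seq_exponents n d (d - i).
Proof.
move=> id dn; apply: funext => j; rewrite /seq_exponents /=.
have -> : (n.-1 - j.+1 == 0)%N = (j.+1 == n.-1) by have := ltn_ord j; lia.
have -> : ((n.-1 - j.+1).+1 == n.-1)%N = (j == 0 :> nat) by have := ltn_ord j; lia.
by rewrite subKn // addnC.
Qed.

Theorem proposition3p3 (R : realType) (A : falgType R[i])
  (mulC : commutative (@GRing.mul A))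
  (e : (\dim {:A}).-tuple A) (e_basis : basis_of {:A} e) :
  [<-> gorenstein A;
       forall b : 'I_(\dim {:A}).-1 -> nat,
         (\sum_j b j)%N = (\dim {:A}).-1 ->
         char_num (@sym_minors _) (form_space e) b =
         char_num (@all_minors _) (mult_space e) b;
       char_seq (@sym_minors _) (form_space e) =
       char_seq (@all_minors _) (mult_space e);
       symmetric_seq (char_seq (@sym_minors _) (form_space e));
       last 0%N (char_seq (@sym_minors _) (form_space e)) = 1%N;
       last 0%N (char_seq (@sym_minors _) (form_space e)) <> 0%N].
Proof.
have n0 := dim_alg_gt0 A.
have symL M : M \in form_space e -> M^T = M.
  by case/mem_form_space => lam ->; apply: form_mx_sym.
have dF := dim_form_space e_basis; have dM := dim_mult_space e_basis.
have nthE (D : coord_choice (\dim {:A})) (L : {vspace 'M[R[i]]_(\dim {:A})}) i :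
    \dim L = \dim {:A} -> (i < \dim {:A})%N ->
    nth 0%N (char_seq D L) i = char_num D L (seq_exponents (\dim {:A}).-1 i).
  by move=> dL ilt; rewrite /char_seq dL (nth_map 0%N) ?size_iota // nth_iota.
have lastE : last 0%N (char_seq (@sym_minors _) (form_space e)) =
    char_num (@sym_minors _) (form_space e) (seq_exponents (\dim {:A}).-1 (\dim {:A}).-1).
  by rewrite -nth_last /char_seq size_map size_iota -/(char_seq _ _) nthE ?dF ?prednK.
have firstE : char_num (@sym_minors _) (form_space e) (seq_exponents (\dim {:A}).-1 0) = 1%N.
  by apply: (char_num_first symL); rewrite prednK.
tfae.
- case/(gorenstein_form_unit e_basis) => lam ulam surj b _.
  apply: (char_num_mulr (G := form_mx e lam)) => //.
    move=> M /mem_form_space[mu ->]; have [a ->] := surj mu.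
    by rewrite -mult_mx_form // mulmxK //; apply/mem_mult_space; exists a.
  move=> M /mem_mult_space[a ->]; rewrite mult_mx_form //.
  by apply/mem_form_space; eexists.
- move=> h; rewrite /char_seq dF dM; apply/eq_in_map => i.
  rewrite mem_iota /= add0n => ilt; apply: h.
  by rewrite sum_seq_exponents // -ltnS prednK.
- move=> -> i; rewrite /char_seq size_map size_iota -/(char_seq _ _) dM => ilt.
  have id : (i <= (\dim {:A}).-1)%N by rewrite -ltnS prednK.
  have ilt' : ((\dim {:A}).-1 - i < \dim {:A})%N.
    by rewrite (leq_ltn_trans (leq_subr _ _)) // prednK.
  rewrite (nthE _ _ _ dM ilt) (nthE _ _ _ dM ilt').
  rewrite -(seq_exponents_rev id erefl).
  have one_mult : 1%:M \in mult_space e by apply/mem_mult_space; exists 1; rewrite mult_mx1.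
  exact: (char_num_invmx _ n0 one_mult (mult_space_invmx mulC e_basis)).
(* Symmetry at index 0 equates the last term with the first. *)
- move=> sym; rewrite lastE -firstE.
  have last_lt : ((\dim {:A}).-1 < \dim {:A})%N by rewrite prednK.
  rewrite -(nthE _ _ _ dF last_lt) -(nthE _ _ _ dF n0).
  have := sym 0%N; rewrite /char_seq size_map size_iota -/(char_seq _ _) dF subn0.
  by move=> ->.
- by move=> ->.
- move=> h; apply: contrapT => notG; apply: h.
  by rewrite lastE; exact: char_num_last_not_gorenstein.
Qed.
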